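(* Endow $\mathbb{R}$ with the usual distance and the Lebesgue measure. Then there exists a set $E\subset\mathbb{R}$ such that $h_E$ satisfies the doubling condition and such that, for all $\alpha<1$ with $\alpha\neq0$, the function $w_\alpha:=\operatorname{dist}(\cdot,E)^{-\alpha}$ is a doubling weight in $\mathbb{R}$ that does not belong to $A_\infty(\mathbb{R})$. In particular, $E$ is not weakly porous.
   Context: $\operatorname{dist}(x,E)=\inf\{|x-y|:y\in E\}$; for $\alpha>0$, $\operatorname{dist}(x,E)^{-\alpha}=+\infty$ when $\operatorname{dist}(x,E)=0$. $|\cdot|$ denotes Lebesgue measure, and $B(x,R)=(x-R,x+R)$. Maximal $E$-free hole: for $B=B(x,R)$, $h_E(B)=\sup\{0<r\le 2R:\ \text{there exists } y\in\mathbb{R}\text{ with }B(y,r)\subset B(x,R)\setminus E\}$, with $h_E(B)=0$ if there is no such $r$. $h_E$ satisfies the doubling condition if there is $C>0$ with $h_E(B(x,2R))\le C\,h_E(B(x,R))$ for all $x\in\mathbb{R}$, $R>0$. $E$ is weakly porous if there are constants $c,\delta\in(0,1)$ such that for every ball $B=B(x,R)$ there is a finite collection of mutually disjoint balls $B_i=B(x_i,r_i)$, $i=1,\dots,N$, contained in $B\setminus E$, with $\delta h_E(B)\le r_i\le 2R$ for every $i$ and $\sum_{i=1}^N|B_i|\ge c|B|$. A weight is a nonnegative locally integrable function. Writing $w(J)=\int_J w\,dx$, a weight $w$ in $\mathbb{R}$ is doubling if there is a constant $C$ with $w(K)\le C\,w(J)$ whenever $J\subset K\subset\mathbb{R}$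 are bounded intervals with $|K|\le 2|J|$. A weight $w$ belongs to $A_1(\mathbb{R})$ if there is $C\ge0$ with $\frac1{|B|}\int_B w\le C\operatorname{ess\,inf}_B w$ for all intervals $B$; for $1<p<\infty$, $w\in A_p(\mathbb{R})$ if $\sup_B\left(\frac1{|B|}\int_B w\right)\left(\frac1{|B|}\int_B w^{\frac1{1-p}}\right)^{p-1}<\infty$, the supremum being over all bounded open intervals $B$. $A_\infty(\mathbb{R})=\bigcup_{p\ge1}A_p(\mathbb{R})$. *)

(* Defs.v *)
From HB Require Import structures.
From mathcomp Require Import all_boot all_order all_algebra.
From mathcomp Require Import all_classical all_reals all_analysis.
From mathcomp Require Import ess_sup_inf.

Set Implicit Arguments.
Unset Strict Implicit.
Unset Printing Implicit Defensive.

Import Order.TTheory GRing.Theory Num.Theory.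
Import numFieldNormedType.Exports.

Local Open Scope classical_set_scope.
Local Open Scope ring_scope.

Section Porosity.
Context {R : realType}.
Local Notation mu := (@lebesgue_measure R).
Implicit Types (E : set R) (x r : R).

(* The set is bounded above by 2 * r, and [sup set0 = 0] gives the convention
   that the value is 0 when the ball has no E-free sub-ball. *)
Definition max_hole E x r : R :=
  sup [set s | 0 < s <= 2 * r /\ exists y, ball y s `<=` ball x r `\` E].

Definition doubling_max_hole E : Prop :=
  exists C : R, 0 < C /\
    forall x r, 0 < r -> max_hole E x (2 * r) <= C * max_hole E x r.

Definition weakly_porous E : Prop :=
  exists c delta : R, [/\ 0 < c < 1, 0 < delta < 1 &
    forall x r, 0 < r ->
      exists (N : nat) (xs rs : 'I_N -> R),
        [/\ forall i, 0 < rs i,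
            trivIset [set: 'I_N] (fun i => ball (xs i) (rs i)),
            forall i, ball (xs i) (rs i) `<=` ball x r `\` E,
            forall i, delta * max_hole E x r <= rs i <= 2 * r &
            (c%:E * mu (ball x r) <= \sum_(i < N) mu (ball (xs i) (rs i)))%E]].

End Porosity.

Section Weights.
Context {R : realType}.
Local Notation mu := (@lebesgue_measure R).
Local Open Scope ereal_scope.
Implicit Types (w : R -> \bar R) (E B J K : set R).

(* Infinite when E is empty. *)
Definition dist E (x : R) : \bar R :=
  ereal_inf [set `|x - y|%:E | y in E].

(* The library power has 0 `^ s = 0 for s < 0; here that value is +oo. *)
Definition epow (x : \bar R) (s : R) : \bar R :=
  if (x == 0) && (s < 0)%R then +oo else x `^ s.

Definition dist_weight E (alpha : R) : R -> \bar R :=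
  fun x => epow (dist E x) (- alpha)%R.

(* [integrable] includes measurability on K. *)
Definition weight w : Prop :=
  (forall x, 0 <= w x) /\ (forall K, compact K -> mu.-integrable K w).

Definition doubling_weight w : Prop :=
  weight w /\
  exists C : R, forall J K : set R,
    is_interval J -> is_interval K -> bounded_set K -> J `<=` K ->
    mu K <= 2%:E * mu J ->
    \int[mu]_(x in K) w x <= C%:E * \int[mu]_(x in J) w x.

Definition avg w B : \bar R := (mu B)^-1 * \int[mu]_(x in B) w x.

Definition muckenhoupt_A1 w : Prop :=
  weight w /\
  exists C : R, (0 <= C)%R /\ forall a b : R, (a < b)%R ->
    avg w `]a, b[
    <= C%:E * ess_inf (mrestr mu (measurable_itv `]a, b[)) w.

Definition muckenhoupt_Ap (p : R) w : Prop :=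
  weight w /\
  ereal_sup [set v | exists a b : R, (a < b)%R /\
    v = avg w `]a, b[
        * (avg (fun x => epow (w x) (1 - p)^-1%R) `]a, b[) `^ (p - 1)%R] < +oo.

Definition muckenhoupt_Ainfty w : Prop :=
  muckenhoupt_A1 w \/ exists p : R, (1 < p)%R /\ muckenhoupt_Ap p w.

End Weights.

(* Main.v *)
(** The set E is a union of finite sets E_n in [-5^n, 5^n], where E_0 = {-1, 1}
    and E_(n+1) is E_n together with two copies of E_n scaled by 2 and centred
    at +-3 5^n.  The gaps of E are then distributed like a multiplicative
    cascade: the weight dist(., E)^(-s) has mass proportional to
    (1 + 2 2^(1-s))^n on [-5^n, 5^n], the largest hole there has radius 2^n, and
    the three parts of a block always share its mass in the same proportions.
    Adjacent parts differ in size by a factor 2 only, so E looks alike on both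
    sides of a common endpoint, and doubling follows by rescaling.  The
    integral of the weight and the size of the largest hole obey the same
    rules, and both are treated as one set function on intervals.

    On the other hand the scaling factor X of a random part of a block, chosen
    with probability proportional to length, is 1 or 2 with probabilities 1/5
    and 4/5, so by strict convexity E[X^(-s)] E[X^(s/(p-1))]^(p-1) > 1 when
    s <> 0: the A_p quotients of the blocks grow geometrically, and a weight in
    A_1 would have bounded A_2 quotients.  Weak porosity fails
    because the integral of dist(., E) over [-5^n, 5^n] is O(9^n), whereas
    disjoint holes of radius at least delta 2^n filling a fixed proportion of the
    block would make it at least of order 10^n. *)

Require Import Defs.
From mathcomp Require Import all_boot all_order all_algebra.
From mathcomp Require Import all_classical all_reals all_analysis.
From mathcomp Require Import ess_sup_inf measurable_realfun ring lra.

Set Implicit Arguments.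
Unset Strict Implicit.
Unset Printing Implicit Defensive.

Import Order.TTheory GRing.Theory Num.Theory.
Import numFieldNormedType.Exports.

Local Open Scope classical_set_scope.
Local Open Scope ring_scope.

(** * Doubling of self-similar set functions *)

Section SelfSimilarDoubling.
Context {R : realType} (M : R -> R -> R) (k : R).
Implicit Types a b c d e r s t u v w z C : R.
Hypothesis k0 : 0 < k.
Hypothesis M_ge0 : forall a b, a <= b -> 0 <= M a b.
Hypothesis M_mono : forall a b c d, a <= c -> c <= d -> d <= b -> M c d <= M a b.
Hypothesis M_sym : forall a b, M (- b) (- a) = M a b.
Hypothesis M_split : forall n a b, a <= 5 ^+ n <= b ->
  M a b <= M a (5 ^+ n) + M (5 ^+ n) b.
Hypothesis M_scale : forall n a b, - 5 ^+ n <= a -> a <= b -> b <= 5 ^+ n ->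
  M (2 * a + 3 * 5 ^+ n) (2 * b + 3 * 5 ^+ n) = k * M a b.
Hypothesis M_base_lower : exists c q, 0 < c /\
  forall a b, -1 <= a -> a <= b -> b <= 1 -> c * ((b - a) / 2) ^+ q <= M a b.
Hypothesis M_base_doubling : exists C, forall a b c d,
  -1 <= a -> a <= c -> c <= d -> d <= b -> b <= 1 -> b - a <= 2 * (d - c) ->
  M a b <= C * M c d.
Hypothesis M_base_straddle : exists C, forall s t u v,
  0 <= s <= 2 -> 0 <= t <= 4 -> u <= v ->
  (1 - s <= u /\ v <= 1) \/ (1 <= u /\ v <= 1 + t) ->
  s + t <= 4 * (v - u) ->
  M (1 - s) 1 + M 1 (1 + t) <= C * M u v.

Let m n := M (- 5 ^+ n) (5 ^+ n).

Let p5 n : 0 < 5 ^+ n :> R. Proof. by rewrite exprn_gt0. Qed.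

Lemma block_child n a b : 5 ^+ n <= a -> a <= b -> b <= 5 ^+ n.+1 ->
  M a b = k * M ((a - 3 * 5 ^+ n) / 2) ((b - 3 * 5 ^+ n) / 2).
Proof.
rewrite exprS => h1 h2 h3; rewrite -(@M_scale n); [|lra|lra|lra].
by congr M; lra.
Qed.

(** The outer children each carry [k * m n], the left one by [M_sym]; the bound is one-sided because
    [M_split] is. *)
Lemma block_step n : m n.+1 <= (1 + 2 * k) * m n.
Proof.
have p := p5 n; have e : 5 ^+ n.+1 = 5 * 5 ^+ n :> R by rewrite exprS.
have h1 : M (5 ^+ n) (5 ^+ n.+1) = k * m n.
  by rewrite (@block_child n) ?e; [congr (_ * M _ _); lra|lra|lra|lra].
have h2 : M (- 5 ^+ n) (5 ^+ n.+1) <= m n + k * m n.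
  by rewrite -h1; apply: M_split; rewrite e; lra.
have h3 : m n.+1 <= M (- 5 ^+ n.+1) (5 ^+ n) + M (5 ^+ n) (5 ^+ n.+1).
  by apply: M_split; rewrite e; lra.
rewrite -(opprK (5 ^+ n)) M_sym opprK in h3.
by rewrite mulrDl; lra.
Qed.

Lemma block_ge0 n : 0 <= m n.
Proof. by apply: M_ge0; have := p5 n; lra. Qed.

(** At least half of [a, b] lies in the middle child or in the right one, and pulling back from the
    right child halves lengths, hence the factor 4; [Num.min 1 k] covers both cases. *)
Lemma child_half n a b : - 5 ^+ n <= a -> a <= b -> b <= 5 ^+ n.+1 ->
  exists u v, [/\ - 5 ^+ n <= u, u <= v, v <= 5 ^+ n, b - a <= 4 * (v - u) &
    Num.min 1 k * M u v <= M a b].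
Proof.
have := p5 n; have : 5 ^+ n.+1 = 5 * 5 ^+ n :> R by rewrite exprS.
move Dp : (5 ^+ n) => p e1 pp; rewrite e1 => g1 g2 g3.
have mleft u v : u <= v -> a <= u -> v <= b -> Num.min 1 k * M u v <= M a b.
  move=> uv au vb; apply: (le_trans _ (M_mono au uv vb)).
  by rewrite ler_piMl ?M_ge0// ge_min lexx.
have mright u v : p <= u -> u <= v -> v <= 5 * p -> a <= u -> v <= b ->
    Num.min 1 k * M ((u - 3 * p) / 2) ((v - 3 * p) / 2) <= M a b.
  move=> pu uv vp au vb; apply: (le_trans _ (M_mono au uv vb)).
  rewrite (@block_child n u v) ?Dp ?e1//; apply: ler_wpM2r; last first.
    by rewrite ge_min lexx orbT.
  by apply: M_ge0; lra.
have /orP[bp|pb] := le_total b p.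
  by exists a, b; split=> //; [lra|exact: mleft].
have /orP[pa|ap] := le_total p a.
  exists ((a - 3 * p) / 2), ((b - 3 * p) / 2); split; [lra|lra|lra|lra|].
  exact: mright.
have /orP[hl|hr] := le_total (b - a) (2 * (p - a)).
  by exists a, p; split=> //; [lra|exact: mleft].
exists ((p - 3 * p) / 2), ((b - 3 * p) / 2); split; [lra|lra|lra|lra|].
by apply: mright => //; lra.
Qed.

(* Induction on n: the larger of the parts of [a, b] lying in two adjacent
   children is at least half of [a, b], while a child is at most 2/5 of its
   parent, so the relative length grows by 5/4; q is chosen to make this gain
   outweigh the loss of mass in the child. *)
Lemma block_lower : exists c q, 0 < c /\
  forall n a b, - 5 ^+ n <= a -> a <= b -> b <= 5 ^+ n ->
    c * ((b - a) / 2 / 5 ^+ n) ^+ q * m n <= M a b.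
Proof.
have [c0 [q0 [c0p H0]]] := M_base_lower.
pose k1 := Num.min 1 k; have k1p : 0 < k1 by rewrite lt_min ltr01.
have k1le1 : k1 <= 1 by rewrite ge_min lexx.
have k1lek : k1 <= k by rewrite ge_min lexx orbT.
have [q1 Hq1] : exists q1 : nat, (1 + 2 * k) / k1 <= (5 / 4) ^+ q1.
  have [N hN] : exists N : nat, (1 + 2 * k) / k1 * 4 <= N%:R.
    exists (Num.truncn ((1 + 2 * k) / k1 * 4)).+1.
    by apply/ltW/truncnS_gt.
  (* Bernoulli's inequality for (1 + 1/4)^N. *)
  exists N; apply: (@le_trans _ _ (1 + N%:R / 4)); first by lra.
  elim: (N) => [|j IH]; first by rewrite expr0 mul0r addr0.
  rewrite exprS -natr1; have j0 : 0 <= j%:R :> R by rewrite ler0n.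
  by nra.
pose q := (q0 + q1)%N.
have Hq : (1 + 2 * k) / k1 <= (5 / 4) ^+ q.
  apply: (le_trans Hq1); rewrite /q [leRHS]exprD -[leLHS]mul1r.
  by apply: ler_wpM2r; [rewrite exprn_ge0//; lra|rewrite exprn_ege1//; lra].
have m0 := block_ge0 0.
(* The first term serves the base case, where the added 1 allows [m 0 = 0]; the second serves
   intervals containing the middle child. *)
pose c := Num.min (c0 / (1 + m 0)) (1 + 2 * k)^-1.
have cp : 0 < c by rewrite lt_min divr_gt0//= ?invr_gt0; lra.
have c1 : c * m 0 <= c0.
  have : c <= c0 / (1 + m 0) by rewrite ge_min lexx.
  by rewrite ler_pdivlMr; [nra|lra].
have c2 : c * (1 + 2 * k) <= 1.
  rewrite -ler_pdivlMr ?div1r; first by rewrite ge_min lexx orbT.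
  by lra.
have xq (x : R) : 0 <= x -> x <= 1 -> x ^+ q <= x ^+ q0.
  by move=> x0 x1; rewrite /q [leLHS]exprD ler_piMr ?exprn_ge0// exprn_ile1.
clearbody q c; exists c, q; split=> //; elim=> [a b|n IH a b].
  rewrite expr0 divr1 => h1 h2 h3.
  have x0 : 0 <= (b - a) / 2 by lra.
  have x1 : (b - a) / 2 <= 1 by lra.
  apply: le_trans (H0 _ _ h1 h2 h3).
  rewrite mulrAC; apply: ler_pM => //.
  - by rewrite mulr_ge0// ltW.
  - by rewrite exprn_ge0.
  - exact: xq.
have := p5 n; move e : (5 ^+ n) => p pp.
have e1 : 5 ^+ n.+1 = 5 * p :> R by rewrite exprS e.
have mS := block_step n; have mn := block_ge0 n; have mn1 := block_ge0 n.+1.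
rewrite e1 => h1 h2 h3.
have x0 : 0 <= (b - a) / 2 / (5 * p) by rewrite !divr_ge0//; lra.
have x1 : (b - a) / 2 / (5 * p) <= 1 by rewrite ler_pdivrMr; lra.
case: (boolP ((a <= - p) && (p <= b))) => [/andP[h4 h5]|ns].
  have : m n <= M a b by rewrite /m e; apply: M_mono => //; lra.
  apply: le_trans; apply: (@le_trans _ _ (c * m n.+1)).
    by rewrite ler_wpM2r// ler_piMr ?exprn_ile1// ltW.
  by apply: (@le_trans _ _ (c * ((1 + 2 * k) * m n))); nra.
have key u v : - p <= u -> u <= v -> v <= p -> b - a <= 4 * (v - u) ->
    k1 * M u v <= M a b ->
    c * ((b - a) / 2 / (5 * p)) ^+ q * m n.+1 <= M a b.
  move=> hu uv hv l; apply: le_trans.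
  have := IH u v; rewrite e => /(_ hu uv hv) /(ler_wpM2l (ltW k1p)).
  apply: le_trans.
  apply: (@le_trans _ _ (c * ((b - a) / 2 / (5 * p)) ^+ q * ((1 + 2 * k) * m n))).
    by rewrite ler_wpM2l// mulr_ge0 ?exprn_ge0// ltW.
  set X := (_ / _) ^+ q; set Y := (_ / _) ^+ q.
  suff XY : (1 + 2 * k) * X <= k1 * Y.
    rewrite (_ : c * X * _ = c * m n * ((1 + 2 * k) * X)); last by ring.
    rewrite (_ : k1 * _ = c * m n * (k1 * Y)); last by ring.
    by apply: ler_wpM2l => //; rewrite mulr_ge0// ltW.
  (* [u, v] has at least a quarter of the length of [a, b], in a block five times smaller. *)
  have XY : (5 / 4) ^+ q * X <= Y.
    rewrite -exprMn; apply: lerXn2r; rewrite ?nnegrE.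
    - by rewrite mulr_ge0//; lra.
    - by rewrite !divr_ge0//; lra.
    rewrite ler_pdivlMr//.
    have -> : 5 / 4 * ((b - a) / 2 / (5 * p)) * p = (b - a) / 8 by field; lra.
    by lra.
  apply: (@le_trans _ _ (k1 * ((5 / 4) ^+ q * X))); last by rewrite ler_wpM2l// ltW.
  rewrite mulrA; apply: ler_wpM2r; first exact: exprn_ge0.
  by rewrite [leRHS]mulrC -ler_pdivrMr.
have right a' b' : - p <= a' -> a' <= b' -> b' <= 5 * p ->
    exists u v, [/\ - p <= u, u <= v, v <= p, b' - a' <= 4 * (v - u) &
      k1 * M u v <= M a' b'].
  by have := @child_half n a' b'; rewrite e e1.
have [pa|ap] := boolP (- p <= a).
  have [u [v [? ? ? ? ?]]] := right a b pa h2 h3.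
  exact: (key u v).
rewrite -ltNge in ap.
have bp : b <= p by move: ns; rewrite (ltW ap) /= -ltNge => /ltW.
(* [a, b] starts in the left child and ends before the right one, so it is reflected. *)
have [u [v [g1 g2 g3 g4]]] : exists u v, [/\ - p <= u, u <= v, v <= p,
    - a - - b <= 4 * (v - u) & k1 * M u v <= M (- b) (- a)].
  by apply: right; lra.
rewrite M_sym => g5; apply: (key u v) => //; lra.
Qed.

(** The constant depends on [e] alone, since [block_lower] sees only relative lengths. This settles
    the cases below in which an interval is comparable to its block. *)
Lemma block_fraction (e : R) : 0 < e -> exists c, 0 < c /\
  forall n a b, - 5 ^+ n <= a -> b <= 5 ^+ n -> e * 5 ^+ n <= b - a ->
    c * m n <= M a b.
Proof.
move=> e0; have [c [q [c0 H]]] := block_lower.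
exists (c * (e / 2) ^+ q); split; first by rewrite mulr_gt0// exprn_gt0// divr_gt0.
move=> n a b h1 h2 h3; have ab : a <= b.
  by rewrite -subr_ge0 (le_trans _ h3)// mulr_ge0// ltW.
apply: le_trans (H n a b h1 ab h2); apply: ler_wpM2r; first exact: block_ge0.
apply: ler_wpM2l; first exact: ltW.
have le : e / 2 <= (b - a) / 2 / 5 ^+ n.
  by rewrite ler_pdivlMr// mulrAC ler_pM2r ?invr_gt0.
have e20 : 0 <= e / 2 by rewrite divr_ge0// ltW.
by apply: lerXn2r; rewrite ?nnegrE// (le_trans e20).
Qed.

(* Around their common endpoint, the block ending at 5^(n+1) and its right
   neighbour look like those at 5^n scaled by 2. *)
Lemma straddle_zoom n u v : u <= v -> 
  (5 ^+ n <= u /\ v <= 5 ^+ n.+1) \/ (5 ^+ n.+1 <= u /\ v <= 13 * 5 ^+ n) ->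
  M u v = k * M ((u - 3 * 5 ^+ n) / 2) ((v - 3 * 5 ^+ n) / 2).
Proof.
move=> uv [[h1 h2]|]; first exact: block_child.
have e : 5 ^+ n.+1 = 5 * 5 ^+ n :> R by rewrite exprS.
have e2 : 5 ^+ n.+2 = 25 * 5 ^+ n :> R by rewrite !exprS; lra.
have p := p5 n; rewrite e => -[h1 h2].
(* The leftmost child of the block [5^(n+1), 5^(n+2)] ends at 13 5^n. Undoing two scalings on either
   side of the equation leaves intervals that are mirror images. *)
rewrite (@block_child n.+1) ?e ?e2//; last by lra.
rewrite -M_sym (@block_child n) ?e; [|lra|lra|lra].
congr (_ * _); rewrite [in RHS](@block_child n) ?e; [|lra|lra|lra].
by rewrite -[in RHS]M_sym; congr (_ * M _ _); field.
Qed.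

(** Induction on n: while both sides are short, [straddle_zoom] moves the picture one level down;
    once one side is long, [u, v] is comparable to the block and [block_fraction] applies. *)
Lemma straddle : exists C, forall n s t u v,
  0 <= s <= 2 * 5 ^+ n -> 0 <= t <= 4 * 5 ^+ n -> u <= v ->
  (5 ^+ n - s <= u /\ v <= 5 ^+ n) \/ (5 ^+ n <= u /\ v <= 5 ^+ n + t) ->
  s + t <= 4 * (v - u) ->
  M (5 ^+ n - s) (5 ^+ n) + M (5 ^+ n) (5 ^+ n + t) <= C * M u v.
Proof.
(* In the second case [u, v] has length at least 5^n, possibly halved by a pull-back, and is
   compared with 5^(n+1). *)
have e0 : 0 < 10^-1 :> R by rewrite invr_gt0.
have [C0 H0] := M_base_straddle; have [c1 [c1p H]] := block_fraction e0.
pose C := Num.max C0 ((1 + k) / (Num.min 1 k * c1)).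
have C0C : C0 <= C by rewrite le_max lexx.
have C1C : 1 + k <= C * (Num.min 1 k * c1).
  rewrite -ler_pdivrMr; first by rewrite le_max lexx orbT.
  by rewrite mulr_gt0// lt_min ltr01.
have Cp : 0 <= C.
  rewrite le_max; apply/orP; right; apply: divr_ge0; first by rewrite addr_ge0// ltW.
  by rewrite mulr_ge0 ?(ltW c1p)// le_min ler01 ltW.
clearbody C; exists C; elim=> [|n IH] s t u v.
  rewrite expr0 => h1 h2 h3 h4 h5.
  apply: (le_trans (H0 _ _ _ _ _ _ h3 h4 h5)); [lra|lra|].
  by apply: ler_wpM2r => //; exact: M_ge0.
have p := p5 n; have e : 5 ^+ n.+1 = 5 * 5 ^+ n :> R by rewrite exprS.
rewrite {1 2}e => h1 h2 h3 h4 h5.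
(* The thresholds are the range of [straddle_zoom]; beyond them s + t > 4 5^n. *)
have [small|big] := boolP ((s <= 4 * 5 ^+ n) && (t <= 8 * 5 ^+ n)).
  clear H0 H C1C C0C.
  have [s4 t8] := andP small.
  rewrite e in h4 *.
  rewrite (@straddle_zoom n u v) ?e//; last first.
    by case: h4 => -[h4 h6]; [left|right]; split; lra.
  rewrite (@straddle_zoom n (5 * 5 ^+ n - s)) ?e; [|lra|by left; split; lra].
  rewrite (@straddle_zoom n (5 * 5 ^+ n) (5 * 5 ^+ n + t)) ?e;
    [|lra|by right; split; lra].
  rewrite -mulrDr mulrCA ler_pM2l//.
  have := IH (s / 2) (t / 2) ((u - 3 * 5 ^+ n) / 2) ((v - 3 * 5 ^+ n) / 2).
  rewrite (_ : (5 * 5 ^+ n - s - 3 * 5 ^+ n) / 2 = 5 ^+ n - s / 2); last by field.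
  rewrite (_ : (5 * 5 ^+ n - 3 * 5 ^+ n) / 2 = 5 ^+ n); last by field.
  rewrite (_ : (5 * 5 ^+ n + t - 3 * 5 ^+ n) / 2 = 5 ^+ n + t / 2); last by field.
  apply; [lra|lra|lra| |lra].
  by case: h4 => -[h4 h6]; [left|right]; split; lra.
have vu : 5 ^+ n <= v - u by move: big; rewrite negb_and -!ltNge => /orP[] ?; lra.
have e2 : 5 ^+ n.+2 = 5 * 5 ^+ n.+1 :> R by rewrite exprS.
have lhs : M (5 ^+ n.+1 - s) (5 ^+ n.+1) + M (5 ^+ n.+1) (5 ^+ n.+1 + t) <=
    (1 + k) * m n.+1.
  rewrite mulrDl mul1r; apply: lerD.
    by apply: M_mono; rewrite ?e; lra.
  apply: (@le_trans _ _ (M (5 ^+ n.+1) (5 ^+ n.+2))).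
    by apply: M_mono; rewrite ?e2 ?e; lra.
  have pS := p5 n.+1.
  suff -> : M (5 ^+ n.+1) (5 ^+ n.+2) = k * m n.+1 by [].
  by rewrite (@block_child n.+1) ?e2; [congr (_ * M _ _); lra|lra..].
apply: (le_trans lhs).
have [w [z [z1 z2 z3 z4 z5]]] : exists w z, [/\ - 5 ^+ n.+1 <= w, w <= z,
    z <= 5 ^+ n.+1, 5 ^+ n <= 2 * (z - w) & Num.min 1 k * M w z <= M u v].
  case: h4 => -[h4 h6].
    exists u, v; split=> //; [by rewrite ?e in h4 *; lra|lra|].
    by rewrite ler_piMl ?M_ge0// ge_min lexx.
  exists ((u - 3 * 5 ^+ n.+1) / 2), ((v - 3 * 5 ^+ n.+1) / 2).
  rewrite (@block_child n.+1 u v)//; last by rewrite ?e2 ?e in h6 *; lra.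
  rewrite ?e in h4 h6 *; split; [lra|lra|lra|lra|].
  by rewrite ler_wpM2r ?ge_min ?lexx ?orbT//; apply: M_ge0; lra.
apply: (@le_trans _ _ (C * (Num.min 1 k * M w z))); last exact: ler_wpM2l.
apply: (@le_trans _ _ (C * (Num.min 1 k * c1) * m n.+1)).
  by apply: ler_wpM2r => //; exact: block_ge0.
rewrite -!mulrA; apply: ler_wpM2l => //.
apply: ler_wpM2l; first by rewrite le_min ler01 ltW.
by apply: H => //; rewrite e; lra.
Qed.

(** Induction on the block containing [a, b]. If [a, b] contains the middle child, [block_fraction]
    applies; if it lies in one child, rescaling; if it crosses a common endpoint, [straddle].
    Reflection leaves only the middle and right children to consider. *)
Theorem self_similar_doubling : exists C, forall a b c d,
  a <= c -> c <= d -> d <= b -> b - a <= 2 * (d - c) -> M a b <= C * M c d.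
Proof.
(* When [a, b] contains the middle child, d - c is at least 5^n, a fifth of 5^(n+1). *)
have e0 : 0 < 5^-1 :> R by rewrite invr_gt0.
have [C0 H0] := M_base_doubling; have [c1 [c1p L]] := block_fraction e0.
have [C1 S] := straddle.
pose C := Num.max (Num.max C0 C1) c1^-1.
have C0C : C0 <= C by rewrite !le_max lexx.
have C1C : C1 <= C by rewrite !le_max lexx orbT.
have Cp : 0 <= C by rewrite le_max; apply/orP; right; rewrite invr_ge0 ltW.
have C2C : 1 <= C * c1.
  by rewrite -ler_pdivrMr// !le_max div1r lexx orbT.
clearbody C; have main n : forall a b c d, - 5 ^+ n <= a -> b <= 5 ^+ n ->
    a <= c -> c <= d -> d <= b -> b - a <= 2 * (d - c) -> M a b <= C * M c d.
  elim: n => [|n IH] a b c d.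
    rewrite expr0 => h1 h2 h3 h4 h5 h6.
    apply: (le_trans (H0 a b c d _ _ _ _ _ _)) => //.
    by apply: ler_wpM2r => //; exact: M_ge0.
  have p := p5 n; have e : 5 ^+ n.+1 = 5 * 5 ^+ n :> R by rewrite exprS.
  have [/andP[h1 h2] h3 h4 h5 h6 h7 h8|] := boolP ((a <= - 5 ^+ n) && (5 ^+ n <= b)).
    have cd : 5 ^+ n <= d - c by lra.
    apply: (@le_trans _ _ (m n.+1)); first by apply: M_mono => //; lra.
    apply: (@le_trans _ _ (C * c1 * m n.+1)).
      by rewrite ler_peMl ?block_ge0.
    rewrite -mulrA; apply: ler_wpM2l => //.
    by apply: L; rewrite ?e; lra.
  have right a' b' c' d' : - 5 ^+ n <= a' -> b' <= 5 ^+ n.+1 ->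
      a' <= c' -> c' <= d' -> d' <= b' -> b' - a' <= 2 * (d' - c') ->
      M a' b' <= C * M c' d'.
    rewrite e => g1 g2 g3 g4 g5 g6.
    have /orP[bp|pb] := le_total b' (5 ^+ n); first exact: IH.
    have /orP[pa|ap] := le_total (5 ^+ n) a'.
      rewrite (@block_child n a' b') 1?(@block_child n c' d') ?e; [|lra..].
      by rewrite mulrCA ler_pM2l//; apply: IH; lra.
    apply: (le_trans (@M_split n a' b' _)); first by lra.
    (* It suffices to find a piece [u, v] of [c', d'] on one side of 5^n with at least half its
       length: then b' - a' <= 4 (v - u), as [straddle] requires. *)
    have key u v : u <= v -> c' <= u -> v <= d' ->
        v <= 5 ^+ n \/ 5 ^+ n <= u -> d' - c' <= 2 * (v - u) ->
        M a' (5 ^+ n) + M (5 ^+ n) b' <= C * M c' d'.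
      move=> uv cu vd sp l.
      apply: (@le_trans _ _ (C1 * M u v)); last first.
        apply: (@le_trans _ _ (C * M u v)); first by rewrite ler_wpM2r ?M_ge0.
        by rewrite ler_wpM2l ?M_mono.
      have := S n (5 ^+ n - a') (b' - 5 ^+ n) u v.
      rewrite subKr (addrC _ (b' - _)) subrK; apply; [lra|lra|lra| |lra].
      by case: sp => ?; [left|right]; split; lra.
    have /orP[dp|pd] := le_total d' (5 ^+ n).
      by apply: (key c' d') => //; [left|lra].
    have /orP[pc|cp] := le_total (5 ^+ n) c'.
      by apply: (key c' d') => //; [right|lra].
    have /orP[hl|hr] := le_total (d' - c') (2 * (5 ^+ n - c')).
      by apply: (key c' (5 ^+ n)) => //; left.
    by apply: (key (5 ^+ n) d') => //; [right|lra].
  rewrite negb_and -!ltNge => /orP[pa|bp] h1 h2 h3 h4 h5 h6.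
    by apply: right => //; lra.
  by rewrite -(M_sym a) -(M_sym c); apply: right; lra.
exists C => a b c d h1 h2 h3 h4.
have [n hn] : exists n, Num.max `|a| `|b| <= 5 ^+ n :> R.
  exists (Num.truncn (Num.max `|a| `|b|)).+1; apply/ltW/(lt_trans (truncnS_gt _)).
  by rewrite -natrX ltr_nat ltn_expl.
move: hn; rewrite ge_max !ler_norml => /andP[/andP[? _] /andP[_ ?]].
exact: (main n).
Qed.

End SelfSimilarDoubling.

(** * The set and its distance function *)

Section TheSet.
Context {R : realType}.
Implicit Types (x y : R) (n : nat).

Fixpoint block n : set R :=
  if n is n'.+1 then
    [set x | [\/ block n' x, block n' ((x - 3 * 5 ^+ n') / 2) |
              block n' ((x + 3 * 5 ^+ n') / 2)]]
  else [set x | `|x| = 1].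

Definition gapset : set R := \bigcup_n block n.

Lemma exp5_gt0 n : 0 < 5 ^+ n :> R. Proof. exact: exprn_gt0. Qed.

Lemma block_norm n x : block n x -> `|x| <= 5 ^+ n.
Proof.
elim: n x => [x /= ->|n IH x /=]; first by rewrite expr0.
rewrite exprS; have := exp5_gt0 n; move: (5 ^+ n) IH => p IH p0.
by case=> /IH; rewrite !ler_norml => /andP[? ?]; apply/andP; split; lra.
Qed.

Lemma blockN n x : block n x -> block n (- x).
Proof.
elim: n x => [x /=|n IH x /=]; first by rewrite normrN.
case=> /IH h; [by apply: Or31|apply: Or33|apply: Or32]; move: h;
  by congr block; lra.
Qed.

Lemma block_end n : block n (5 ^+ n).
Proof.
elim: n => [/=|n IH /=]; first by rewrite expr0 normr1.
apply: Or32; rewrite exprS; move: IH; congr block; lra.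
Qed.

Lemma block_sub n m x : (n <= m)%N -> block n x -> block m x.
Proof. by move=> /subnK <-; elim: (m - n)%N => //= k IH /IH ?; apply: Or31. Qed.

(** A copy added to stage k >= n lies outside ]-5^k, 5^k[, so it meets [-5^n, 5^n] at most in an
    endpoint, which [block n] already contains. *)
Lemma block_restrict n m x : (n <= m)%N -> block m x -> `|x| <= 5 ^+ n ->
  block n x.
Proof.
move=> /subnK <-; elim: (m - n)%N => //= k IH + xn.
have h : 5 ^+ n <= 5 ^+ (k + n) :> R by rewrite ler_eXn2l ?leq_addl// ltr1n.
have := xn; rewrite ler_norml => /andP[xn1 xn2].
have p := exp5_gt0 n.
case=> hb.
- exact: IH.
- have := block_norm hb; rewrite ler_norml => /andP[h1 _].
  have -> : x = 5 ^+ n by lra.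
  exact: block_end.
- have := block_norm hb; rewrite ler_norml => /andP[_ h2].
  have -> : x = - 5 ^+ n by lra.
  by apply/blockN/block_end.
Qed.

Lemma gapset_block n x : `|x| <= 5 ^+ n -> gapset x -> block n x.
Proof.
move=> xn [m _ hm]; have [mn|nm] := leqP m n; first exact: block_sub hm.
by apply: block_restrict hm xn; exact: ltnW.
Qed.

Lemma gapsetN x : gapset (- x) <-> gapset x.
Proof.
split=> -[n _ h]; exists n => //; last exact: blockN.
by rewrite -(opprK x); exact: blockN.
Qed.

Lemma gapset_end n : gapset (5 ^+ n). Proof. by exists n => //; exact: block_end. Qed.

Lemma gapset_endN n : gapset (- 5 ^+ n). Proof. by apply/gapsetN/gapset_end. Qed.

(** By [gapset_block] only stage n+1 matters; of its three parts, the middle one meets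
    [5^n, 5^(n+1)] only at 5^n and the left one not at all. *)
Lemma gapset_scale n x : `|x| <= 5 ^+ n ->
  gapset (2 * x + 3 * 5 ^+ n) <-> gapset x.
Proof.
move=> xn; split=> [h|/(gapset_block xn) h]; last first.
  by exists n.+1 => //=; apply: Or32; move: h; congr block; lra.
have p := exp5_gt0 n; have := xn; rewrite ler_norml => /andP[h1 h2].
have /gapset_block/(_ h) /= : `|2 * x + 3 * 5 ^+ n| <= 5 ^+ n.+1.
  by rewrite ler_norml exprS; apply/andP; split; lra.
case=> [/block_norm|hb|/block_norm]; rewrite ?ler_norml.
- move=> /andP[_ h3]; have -> : x = - 5 ^+ n by lra.
  exact: gapset_endN.
- by exists n => //; move: hb; congr block; lra.
- by move=> /andP[_ h3]; lra.
Qed.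

Lemma gapset_gap x : `|x| < 1 -> ~ gapset x.
Proof.
move=> x1 /(@gapset_block 0); rewrite expr0 => /(_ (ltW x1)) /= e.
by rewrite e ltxx in x1.
Qed.

Definition gapdist x : R := inf [set `|x - y| | y in gapset].

Lemma gapdist_has_inf x : has_inf [set `|x - y| | y in gapset].
Proof.
split; first by exists `|x - 5 ^+ 0|, (5 ^+ 0) => //; exact: gapset_end.
by exists 0 => _ [y _ <-].
Qed.

Lemma gapdist_le x y : gapset y -> gapdist x <= `|x - y|.
Proof.
by move=> Ey; apply: ge_inf; [exact: (gapdist_has_inf x).2|exists y].
Qed.

Lemma gapdist_ge x r : (forall y, gapset y -> r <= `|x - y|) -> r <= gapdist x.
Proof.
by move=> h; apply: lb_le_inf => [|_ [y Ey <-]];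
  [exact: (gapdist_has_inf x).1|exact: h].
Qed.

Lemma gapdist_ge0 x : 0 <= gapdist x.
Proof. by apply: gapdist_ge => y _; exact: normr_ge0. Qed.

Lemma dist_gapset x : dist gapset x = (gapdist x)%:E.
Proof.
have [ne lb] := gapdist_has_inf x.
rewrite /dist /gapdist -ereal_inf_EFin//; congr ereal_inf.
by rewrite image_comp.
Qed.

Lemma gapdist_lip x y : gapdist x <= gapdist y + `|x - y|.
Proof.
rewrite -lerBlDr; apply: gapdist_ge => z Ez.
rewrite lerBlDr; apply: (le_trans (gapdist_le x Ez)).
by rewrite -(subrKA y) addrC ler_normD.
Qed.

Lemma gapdistN x : gapdist (- x) = gapdist x.
Proof.
have h y : gapdist y <= gapdist (- y).
  apply: gapdist_ge => z Ez; rewrite -normrN opprD opprK.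
  by rewrite -[z]opprK; apply: gapdist_le; apply/gapsetN; rewrite opprK.
by apply/le_anti; rewrite h andbT; have := h (- x); rewrite opprK.
Qed.

(** Points of the set beyond a or b are farther from x than a or b itself, so the distance is
    decided within [a, b]. *)
Lemma gapdist_sub a b x r : gapset a -> gapset b -> a <= x -> x <= b ->
  (forall y, gapset y -> a <= y -> y <= b -> r <= `|x - y|) -> r <= gapdist x.
Proof.
move=> Ea Eb ax xb h; apply: gapdist_ge => y Ey.
have [ya|ay] := ltP y a.
  apply: (le_trans (h a Ea (lexx _) (le_trans ax xb))).
  by rewrite !ger0_norm; lra.
have [by_|yb] := ltP b y; last exact: h.
apply: (le_trans (h b Eb (le_trans ax xb) (lexx _))).
by rewrite !ler0_norm; lra.
Qed.

(** By [gapdist_sub] both distances are decided inside blocks, where [gapset_scale] matches the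
    points of the set. *)
Lemma gapdist_scale n x : `|x| <= 5 ^+ n ->
  gapdist (2 * x + 3 * 5 ^+ n) = 2 * gapdist x.
Proof.
have p := exp5_gt0 n; have e : 5 ^+ n.+1 = 5 * 5 ^+ n :> R by rewrite exprS.
rewrite ler_norml => /andP[x1 x2]; apply/le_anti/andP; split.
  rewrite [leRHS]mulrC -ler_pdivrMr//.
  apply: (gapdist_sub (gapset_endN n) (gapset_end n)) => // y Ey y1 y2.
  rewrite ler_pdivrMr//.
  have E2 : gapset (2 * y + 3 * 5 ^+ n).
    by apply/gapset_scale => //; rewrite ler_norml y1.
  apply: (le_trans (gapdist_le _ E2)).
  rewrite (_ : _ - _ = (x - y) * 2); last by lra.
  by rewrite normrM (ger0_norm (_ : 0 <= 2)).
apply: (gapdist_sub (gapset_end n) (gapset_end n.+1)); rewrite ?e; [lra|lra|].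
move=> y Ey y1 y2; pose z := (y - 3 * 5 ^+ n) / 2.
have yE : y = 2 * z + 3 * 5 ^+ n by rewrite /z; lra.
have Ez : gapset z.
  apply/(@gapset_scale n); first by rewrite ler_norml /z; apply/andP; split; lra.
  by rewrite -yE.
rewrite yE (_ : _ - _ = 2 * (x - z)); last by lra.
rewrite normrM (ger0_norm (_ : 0 <= 2))// ler_pM2l//.
exact: gapdist_le.
Qed.

Lemma gapdist_gap x : `|x| <= 1 -> gapdist x = 1 - `|x|.
Proof.
move=> x1; apply/le_anti/andP; split.
  have [x0|x0] := leP 0 x.
    apply: (le_trans (gapdist_le _ (gapset_end 0))); rewrite expr0.
    rewrite (ger0_norm x0) in x1 *; rewrite ler0_norm; lra.
  apply: (le_trans (gapdist_le _ (gapset_endN 0))); rewrite expr0.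
  rewrite (ltr0_norm x0) in x1 *; rewrite ger0_norm; lra.
apply: gapdist_ge => y Ey.
have y1 : 1 <= `|y| by rewrite leNgt; apply/negP => /gapset_gap.
by rewrite distrC; apply: le_trans (lerB_dist _ _); lra.
Qed.

End TheSet.

(** * Holes *)

Section Holes.
Context {R : realType}.
Implicit Types (x y : R) (n : nat).

Lemma ball_subP (a b y s : R) : 0 < s ->
  ball y s `<=` ball ((a + b) / 2) ((b - a) / 2) <-> a <= y - s /\ y + s <= b.
Proof.
move=> s0; split=> [h|[h1 h2] z]; last first.
  by rewrite /ball /= !ltr_norml => /andP[? ?]; apply/andP; split; lra.
have {}h z : y - s < z -> z < y + s -> a < z /\ z < b.
  move=> z1 z2; have /h : ball y s z by rewrite /ball /= ltr_norml; apply/andP; split; lra.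
  by rewrite /ball /= ltr_norml => /andP[? ?]; split; lra.
(* An end of the ball outside [a, b] yields a point of the ball outside ]a, b[: the centre, or the
   midpoint between that end and a or b. *)
split; rewrite leNgt; apply/negP => l.
  have [ay|ya] := ltP a y; last by have [] := h y; lra.
  by have [] := h ((y - s + a) / 2); lra.
have [yb|by_] := ltP y b; last by have [] := h y; lra.
by have [] := h ((y + s + b) / 2); lra.
Qed.

(** Endpoints replace centre and radius, so that the supremum is a set function as in
    [self_similar_doubling]. *)
Definition hole (E : set R) a b : set R :=
  [set s | 0 < s /\ exists y, [/\ a <= y - s, y + s <= b & ball y s `<=` ~` E]].

Lemma max_holeE (E : set R) a b :
  max_hole E ((a + b) / 2) ((b - a) / 2) = sup (hole E a b).
Proof.
congr sup; apply/seteqP; split=> s /=.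
  move=> [/andP[s0 _] [y h]]; split=> //; exists y.
  have [h1 h2] : a <= y - s /\ y + s <= b.
    by apply/ball_subP => // z /h [].
  by split=> // z /h [].
move=> [s0 [y [h1 h2 h3]]]; split; first by rewrite s0 /=; lra.
exists y => z hz; split; last exact: h3.
by move: z hz; apply/ball_subP.
Qed.

(** The condition [0 <= M] covers the empty set, whose [sup] is 0. *)
Lemma sup_hole_le (E : set R) a b M : 0 <= M -> (forall s, hole E a b s -> s <= M) ->
  sup (hole E a b) <= M.
Proof.
move=> M0 h; have [->|ne] := eqVneq (hole E a b) set0; first by rewrite sup0.
by apply: ge_sup => //; exact/set0P.
Qed.

Lemma hole_le (E : set R) a b s : hole E a b s -> s <= (b - a) / 2.
Proof. by move=> [? [y [? ? _]]]; lra. Qed.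

Lemma sup_hole_ge (E : set R) a b s : hole E a b s -> s <= sup (hole E a b).
Proof.
by move=> h; apply: ub_le_sup => //; exists ((b - a) / 2) => z; exact: hole_le.
Qed.

Lemma sup_hole_ge0 (E : set R) a b : 0 <= sup (hole E a b).
Proof.
have [->|/set0P[s hs]] := eqVneq (hole E a b) set0; first by rewrite sup0.
by apply: le_trans (sup_hole_ge hs); exact/ltW/hs.1.
Qed.

Local Notation H := (fun a b => sup (hole (@gapset R) a b)).

Lemma sup_hole_mono (E : set R) a b c d : a <= c -> d <= b ->
  sup (hole E c d) <= sup (hole E a b).
Proof.
move=> ac db; apply: sup_hole_le; first exact: sup_hole_ge0.
move=> s [s0 [y [h1 h2 h3]]]; apply: sup_hole_ge; split=> //.
by exists y; split=> //; lra.
Qed.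

(** A ball that avoids p lies on one side of it. *)
Lemma sup_hole_split (E : set R) p a b : E p ->
  sup (hole E a b) <= sup (hole E a p) + sup (hole E p b).
Proof.
move=> Ep; apply: sup_hole_le; first by rewrite addr_ge0// sup_hole_ge0.
move=> s [s0 [y [h1 h2 h3]]].
have g1 := sup_hole_ge0 E a p; have g2 := sup_hole_ge0 E p b.
have [le|gt] := leP (y + s) p.
  have hs : hole E a p s by split=> //; exists y.
  by have := sup_hole_ge hs; lra.
have [le|lt] := leP p (y - s).
  have hs : hole E p b s by split=> //; exists y.
  by have := sup_hole_ge hs; lra.
have /h3 : ball y s p by rewrite /ball /= ltr_norml; apply/andP; split; lra.
by move=> /(_ Ep).
Qed.

Lemma hole_sym a b s : hole (@gapset R) a b s -> hole gapset (- b) (- a) s.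
Proof.
move=> [s0 [y [h1 h2 h3]]]; split=> //; exists (- y); split; [lra|lra|].
move=> z hz /= /gapsetN; apply: h3; move: hz.
by rewrite /ball /= (_ : - y - z = - (y - - z)) ?normrN//; lra.
Qed.

Lemma sup_hole_sym a b : H (- b) (- a) = H a b.
Proof.
congr sup; apply/seteqP; split=> s; last exact: hole_sym.
by move=> /hole_sym; rewrite !opprK.
Qed.

Lemma hole_scale n a b s : - 5 ^+ n <= a -> b <= 5 ^+ n ->
  hole (@gapset R) a b s <->
  hole gapset (2 * a + 3 * 5 ^+ n) (2 * b + 3 * 5 ^+ n) (2 * s).
Proof.
move=> a1 b1; split=> [[s0 [y [h1 h2 h3]]]|[s0 [y [h1 h2 h3]]]].
  split; first lra; exists (2 * y + 3 * 5 ^+ n); split; [lra|lra|].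
  move=> z; rewrite /ball /= ltr_norml => /andP[z1 z2].
  have -> : z = 2 * ((z - 3 * 5 ^+ n) / 2) + 3 * 5 ^+ n by lra.
  move/gapset_scale => h; apply: (h3 ((z - 3 * 5 ^+ n) / 2)).
    by rewrite /ball /= ltr_norml; apply/andP; split; lra.
  by apply: h; rewrite ler_norml; apply/andP; split; lra.
split; first lra; exists ((y - 3 * 5 ^+ n) / 2); split; [lra|lra|].
move=> z; rewrite /ball /= ltr_norml => /andP[z1 z2] Ez.
apply: (h3 (2 * z + 3 * 5 ^+ n)).
  by rewrite /ball /= ltr_norml; apply/andP; split; lra.
by apply/gapset_scale => //; rewrite ler_norml; apply/andP; split; lra.
Qed.

Lemma sup_hole_scale n a b : - 5 ^+ n <= a -> b <= 5 ^+ n ->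
  H (2 * a + 3 * 5 ^+ n) (2 * b + 3 * 5 ^+ n) = 2 * H a b.
Proof.
move=> a1 b1; apply/le_anti/andP; split.
  apply: sup_hole_le; first by rewrite mulr_ge0// sup_hole_ge0.
  move=> s hs; have : hole gapset a b (s / 2).
    by apply/(hole_scale _ a1 b1); rewrite (_ : 2 * (s / 2) = s)//; lra.
  by move/sup_hole_ge; lra.
rewrite [leLHS]mulrC -ler_pdivlMr//; apply: sup_hole_le.
  by rewrite divr_ge0// sup_hole_ge0.
by move=> s /(hole_scale _ a1 b1) /sup_hole_ge; lra.
Qed.

Lemma sup_hole_upper (E : set R) a b : a <= b -> sup (hole E a b) <= (b - a) / 2.
Proof.
by move=> ab; apply: sup_hole_le => [|s]; [lra|exact: hole_le].
Qed.

Lemma sup_hole_lower a b : -1 <= a -> a <= b -> b <= 1 -> (b - a) / 2 <= H a b.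
Proof.
move=> a1; rewrite le_eqVlt => /predU1P[->|ab] b1.
  by rewrite subrr mul0r sup_hole_ge0.
apply: sup_hole_ge; split; first lra; exists ((a + b) / 2); split; [lra|lra|].
move=> z; rewrite /ball /= ltr_norml => /andP[z1 z2].
by apply: gapset_gap; rewrite ltr_norml; apply/andP; split; lra.
Qed.

(** On subintervals of [-1, 1] the largest hole has radius exactly half the length, so the base
    conditions are linear; holes double in a scaled copy, hence k = 2. *)
Lemma gapset_doubling_max_hole : doubling_max_hole (@gapset R).
Proof.
have [C hC] : exists C, forall a b c d,
    a <= c -> c <= d -> d <= b -> b - a <= 2 * (d - c) -> H a b <= C * H c d.
  apply: (@self_similar_doubling R H 2) => //.
  - by move=> a b _; exact: sup_hole_ge0.
  - by move=> a b c d ac _; exact: sup_hole_mono.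
  - exact: sup_hole_sym.
  - by move=> n a b _; apply: sup_hole_split; exact: gapset_end.
  - by move=> n a b a1 _; exact: sup_hole_scale.
  - exists 1, 1; split=> // a b a1 ab b1; rewrite mul1r expr1.
    exact: sup_hole_lower.
  - exists 2 => a b c d a1 ac cd db b1 h.
    have := @sup_hole_upper gapset a b; have := @sup_hole_lower c d; lra.
  - exists 4 => s t u v s2 t4 uv huv h.
    have := @sup_hole_upper gapset (1 - s) 1.
    have := @sup_hole_upper gapset 1 (1 + t).
    suff : (v - u) / 2 <= H u v by lra.
    case: huv => -[h1 h2]; first by apply: sup_hole_lower; lra.
    (* ]1, 5[ is a gap too, being ]-1, 1[ scaled by 2. *)
    have := @sup_hole_scale 0 ((u - 3) / 2) ((v - 3) / 2); rewrite expr0.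
    rewrite (_ : 2 * ((u - 3) / 2) + 3 * 1 = u); last lra.
    rewrite (_ : 2 * ((v - 3) / 2) + 3 * 1 = v); last lra.
    have := @sup_hole_lower ((u - 3) / 2) ((v - 3) / 2); lra.
exists (`|C| + 1); split; first by have := normr_ge0 C; lra.
move=> x r r0.
have := hC (x - 2 * r) (x + 2 * r) (x - r) (x + r).
rewrite -!max_holeE.
rewrite (_ : (x - 2 * r + (x + 2 * r)) / 2 = x); last lra.
rewrite (_ : (x - r + (x + r)) / 2 = x); last lra.
rewrite (_ : (x + 2 * r - (x - 2 * r)) / 2 = 2 * r); last lra.
rewrite (_ : (x + r - (x - r)) / 2 = r); last lra.
move=> h; apply: (le_trans (h _ _ _ _)); [lra|lra|lra|lra|].
apply: ler_wpM2r; last by have := ler_norm C; lra.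
have := sup_hole_ge0 gapset (x - r) (x + r); rewrite -max_holeE.
rewrite (_ : (x - r + (x + r)) / 2 = x); last lra.
by rewrite (_ : (x + r - (x - r)) / 2 = r); last lra.
Qed.

End Holes.

(** * The weights *)

Lemma lebesgue_measure_oo {R : realType} (a b : R) : a <= b ->
  lebesgue_measure `]a, b[%classic = (b - a)%:E.
Proof.
move=> ab; rewrite lebesgue_measure_itv /= lte_fin; case: ltP => // ba.
by rewrite (_ : b = a) ?subrr//; lra.
Qed.

(** * Substitution, additivity and bounds for integrals over intervals *)

Section IntervalIntegral.
Context {R : realType}.
Local Notation mu := (@lebesgue_measure R).
Variable f : R -> \bar R.
Hypothesis mf : measurable_fun [set: R] f.
Hypothesis f0 : forall x, (0 <= f x)%E.
Local Open Scope ereal_scope.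

Let mfD (D : set R) : measurable_fun D f. Proof. exact: measurable_funTS. Qed.

(** Lebesgue measure is k times its image under the affine map: the two agree on half-open
    intervals, which determine it. *)
Lemma integral_affine (k c a b : R) : (0 < k)%R ->
  \int[mu]_(x in `](k * a + c)%R, (k * b + c)%R[%classic) f x =
  k%:E * \int[mu]_(x in `]a, b[%classic) f (k * x + c)%R.
Proof.
move=> k0; pose phi (x : measurableTypeR R) : measurableTypeR R := (k * x + c)%R.
have mphi : measurable_fun setT phi.
  by apply: measurable_funD => //; exact: measurable_funM.
pose kk : {nonneg R} := NngNum (ltW k0).
pose m1 := (pushforward mu phi : {measure set (measurableTypeR R) -> \bar R}).
pose m2 : {measure set (measurableTypeR R) -> \bar R} := mscale kk (m1 mphi).
have E A : measurable A -> mu A = m2 A.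
  apply: lebesgue_measure_unique => _ [[x y] _ <-].
  rewrite [RHS](_ : _ = k%:E * mu (phi @^-1` `]x, y]%classic))//.
  have -> : phi @^-1` `]x, y]%classic = `]((x - c) / k)%R, ((y - c) / k)%R]%classic.
    apply/seteqP; split=> z; rewrite /phi /= !in_itv /=.
      by rewrite ltr_pdivrMr// ler_pdivlMr// => /andP[? ?]; apply/andP; split; lra.
    by rewrite ltr_pdivrMr// ler_pdivlMr// => /andP[? ?]; apply/andP; split; lra.
  rewrite !lebesgue_measure_itv /= !lte_fin ltr_pM2r ?invr_gt0//.
  have [xy|xy] := ltP x y; last first.
    by rewrite ifF ?mule0//; apply/negbTE; rewrite -leNgt; lra.
  rewrite ifT; last by lra.
  by rewrite -!EFinD -EFinM; congr EFin; field; lra.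
have mI : measurable (`](k * a + c)%R, (k * b + c)%R[%classic : set (measurableTypeR R)).
  exact: measurable_itv.
rewrite (eq_measure_integral m2); last by move=> A mA _; exact: E.
rewrite ge0_integral_mscale//=; last exact: mfD.
rewrite ge0_integral_pushforward//; last exact: mfD.
congr (_ * integral _ _ _); apply/seteqP; split=> z; rewrite /phi /= !in_itv /=.
  by move=> /andP[h1 h2]; apply/andP; split; nra.
by move=> /andP[h1 h2]; apply/andP; split; nra.
Qed.

Lemma integral_reflect (a b : R) :
  \int[mu]_(x in `](- b)%R, (- a)%R[%classic) f x = \int[mu]_(x in `]a, b[%classic) f (- x)%R.
Proof.
have mI : measurable (`](- b)%R, (- a)%R[%classic : set (measurableTypeR R)).
  exact: measurable_itv.
rewrite (eq_measure_integral (pushforward mu (-%R : _ -> measurableTypeR R)));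
  last by move=> A mA _; exact/esym/lebesgue_measureN.
rewrite ge0_integral_pushforward//; last exact: mfD.
congr (integral _ _ _); apply/seteqP; split=> z; rewrite /= !in_itv /=;
  by move=> /andP[h1 h2]; apply/andP; split; lra.
Qed.

Lemma integral_split (a p b : R) : (a <= p)%R -> (p <= b)%R ->
  \int[mu]_(x in `]a, b[%classic) f x =
  \int[mu]_(x in `]a, p[%classic) f x + \int[mu]_(x in `]p, b[%classic) f x.
Proof.
move=> ap; rewrite le_eqVlt => /predU1P[->|pb].
  by rewrite (@set_itv_ge _ _ (BRight b)) ?integral_set0 ?adde0// bnd_simp ltxx.
rewrite (@integral_itv_bndo_bndc _ (BRight a) p f); last exact: measurable_funTS.
rewrite -ge0_integral_setU//.
- congr (integral _ _ _); rewrite -itv_bndbnd_setU// bnd_simp//.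
- exact: mfD.
- rewrite disj_set2E; apply/eqP/seteqP; split=> x //=; rewrite !in_itv/=.
  by move=> [/andP[_ h1] /andP[h2 _]]; lra.
Qed.

Lemma integral_mono (A B : set R) : measurable A -> measurable B -> A `<=` B ->
  \int[mu]_(x in A) f x <= \int[mu]_(x in B) f x.
Proof. by move=> mA mB AB; apply: ge0_subset_integral => //; exact: mfD. Qed.

Lemma integral_lower (a b c : R) : (a <= b)%R -> (0 <= c)%R ->
  (forall x, (a < x < b)%R -> c%:E <= f x) ->
  (c * (b - a))%:E <= \int[mu]_(x in `]a, b[%classic) f x.
Proof.
move=> ab c0 h; have -> : (c * (b - a))%:E = \int[mu]_(x in `]a, b[%classic) (cst c%:E x).
  by rewrite integral_cst//= lebesgue_measure_oo.
by apply: ge0_le_integral => //; exact: measurable_funTS.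
Qed.

Lemma integral_upper (a b c : R) : (a <= b)%R -> (0 <= c)%R ->
  (forall x, (a < x < b)%R -> f x <= c%:E) ->
  \int[mu]_(x in `]a, b[%classic) f x <= (c * (b - a))%:E.
Proof.
move=> ab c0 h; have -> : (c * (b - a))%:E = \int[mu]_(x in `]a, b[%classic) (cst c%:E x).
  by rewrite integral_cst//= lebesgue_measure_oo.
by apply: ge0_le_integral => //; exact: measurable_funTS.
Qed.

End IntervalIntegral.

(** * The weight as a function: values, measurability, homogeneity *)

Section Weight.
Context {R : realType}.
Local Notation mu := (@lebesgue_measure R).
Implicit Types (s x : R) (n : nat).

Definition wt s : R -> \bar R := dist_weight (@gapset R) s.

Lemma wtE s x : wt s x =
  if (gapdist x == 0) && (0 < s) then +oo%E else (gapdist x `^ (- s))%:E.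
Proof. by rewrite /wt /dist_weight /epow dist_gapset eqe oppr_lt0. Qed.

Lemma wt_fin s x : 0 < gapdist x -> wt s x = (gapdist x `^ (- s))%:E.
Proof. by rewrite wtE => /gt_eqF ->. Qed.

Lemma wt_ge0 s x : (0 <= wt s x)%E.
Proof. by rewrite wtE; case: ifP => // _; rewrite lee_fin powR_ge0. Qed.

Lemma continuous_gapdist : continuous (@gapdist R).
Proof.
move=> x; apply/cvgrPdist_le => e e0; near=> y.
have h : `|x - y| <= e by near: y; move: e e0; exact: (@cvgr_dist_le _ _ _ (nbhs x) _ id x).
rewrite ler_norml; have := gapdist_lip x y; have := gapdist_lip y x.
rewrite (distrC y x) => ? ?; apply/andP; split; lra.
Unshelve. all: by end_near. Qed.

Lemma measurable_gapdist : measurable_fun setT (@gapdist R).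
Proof. exact: continuous_measurable_fun continuous_gapdist. Qed.

Lemma measurable_wt s : measurable_fun setT (wt s).
Proof.
rewrite (funext (wtE s)); apply: measurable_fun_ifT => //.
  apply: measurable_and => //; apply: measurable_fun_eqr => //.
  exact: measurable_gapdist.
apply/measurable_EFinP; apply: (measurableT_comp (measurable_powR _)).
exact: measurable_gapdist.
Qed.

Lemma wtN s x : wt s (- x) = wt s x.
Proof. by rewrite !wtE gapdistN. Qed.

Lemma wt_homog s x y k : 0 < k -> gapdist y = k * gapdist x ->
  wt s y = ((k `^ (- s))%:E * wt s x)%E.
Proof.
move=> k0 e; rewrite !wtE e mulf_eq0 (gt_eqF k0) /=; case: ifP => _.
  by rewrite gt0_muley// lte_fin powR_gt0.
by rewrite powRM ?EFinM// ?gapdist_ge0// ltW.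
Qed.

End Weight.

(** * Comparison of real powers *)

Section PowerBounds.
Context {R : realType}.
Implicit Types (x d s t K l : R).

Lemma powR_le_norm x K t : 1 <= K -> K^-1 <= x -> x <= K -> x `^ t <= K `^ `|t|.
Proof.
move=> K1 Kx xK; have K0 : 0 < K by lra.
have x0 : 0 < x by apply: lt_le_trans Kx; rewrite invr_gt0.
rewrite /powR (gt_eqF x0) (gt_eqF K0) ler_expR.
have lK : ln x <= ln K by rewrite ler_ln.
have lK' : - ln K <= ln x by rewrite -lnV// ler_ln// posrE invr_gt0.
have lK0 : 0 <= ln K by rewrite ln_ge0.
apply: (le_trans (ler_norm _)); rewrite normrM ler_wpM2l//.
by rewrite ler_norml lK lK'.
Qed.

Lemma powR_le_base x y t : 0 <= t -> 0 <= x -> x <= y -> x `^ t <= y `^ t.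
Proof.
move=> t0 x0 xy; apply: ge0_ler_powR; rewrite ?nnegrE//.
exact: le_trans xy.
Qed.

Lemma powR_le1 x t : 0 <= t -> 0 <= x -> x <= 1 -> x `^ t <= 1.
Proof. by move=> t0 x0 x1; have := powR_le_base t0 x0 x1; rewrite powR1. Qed.

Lemma powR_ge1 x t : 0 <= t -> 1 <= x -> 1 <= x `^ t.
Proof. by move=> t0 x1; have := powR_le_base t0 ler01 x1; rewrite powR1. Qed.

(** The exponent |s| on K treats increasing and decreasing powers alike; used where the distance is
    comparable to a fixed length. *)
Lemma powR_comparable l d s K : 0 < l -> 1 <= K -> l / K <= d -> d <= K * l ->
  (K `^ `|s|)^-1 * l `^ (- s) <= d `^ (- s) <= K `^ `|s| * l `^ (- s).
Proof.
move=> l0 K1 h1 h2; have K0 : 0 < K by lra.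
have d0 : 0 < d by apply: lt_le_trans h1; rewrite divr_gt0.
have -> : d = d / l * l by rewrite divfK// gt_eqF.
rewrite (powRM (- s) (ltW (divr_gt0 d0 l0)) (ltW l0)).
have xK : d / l <= K by rewrite ler_pdivrMr.
have Kx : K^-1 <= d / l by rewrite ler_pdivlMr// mulrC.
apply/andP; split; apply: ler_wpM2r; rewrite ?powR_ge0//; last first.
  by rewrite -normrN; exact: powR_le_norm.
have x0 : 0 < d / l by rewrite divr_gt0.
rewrite invf_ple ?posrE ?powR_gt0// -powRN -(normrN s).
rewrite -[`|- s|]normrN; exact: powR_le_norm.
Qed.

End PowerBounds.

(** * The mass of intervals, its scaling laws and its finiteness *)

Section Mass.
Context {R : realType}.
Local Notation mu := (@lebesgue_measure R).
Implicit Types (s a b x : R) (n : nat).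

Definition mass s a b : \bar R := (\int[mu]_(x in `]a, b[%classic) wt s x)%E.
(** Scaling by 2 multiplies lengths by 2 and the weight by 2^(-s). *)
Definition growth s : R := 2 `^ (1 - s).

Lemma growth_gt0 s : 0 < growth s. Proof. exact: powR_gt0. Qed.

Lemma mass_ge0 s a b : (0 <= mass s a b)%E.
Proof. by apply: integral_ge0 => x _; exact: wt_ge0. Qed.

Lemma mass_eq s a b c d : a = c -> b = d -> mass s a b = mass s c d.
Proof. by move=> -> ->. Qed.

Lemma massN s a b : mass s (- b) (- a) = mass s a b.
Proof.
rewrite /mass (integral_reflect (measurable_wt s) (wt_ge0 s)).
by apply: eq_integral => x _; rewrite wtN.
Qed.

Lemma mass_homog s k c a b : 0 < k ->
  (forall x, a < x < b -> gapdist (k * x + c) = k * gapdist x) ->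
  mass s (k * a + c) (k * b + c) = ((k `^ (1 - s))%:E * mass s a b)%E.
Proof.
move=> k0 h.
rewrite /mass (integral_affine (measurable_wt s) (wt_ge0 s))//.
rewrite (@eq_integral _ _ _ mu _ (fun x => (k `^ (- s))%:E * wt s x)%E); last first.
  by move=> x; rewrite inE /= in_itv /= => /h; exact: wt_homog.
rewrite ge0_integralZl//=; last 3 first.
- exact: measurable_funTS (measurable_wt s).
- by move=> x _; exact: wt_ge0.
- by rewrite lee_fin powR_ge0.
rewrite muleA -EFinM powRD ?powRr1 ?ltW//.
by apply/implyP => _; rewrite gt_eqF.
Qed.

Lemma mass_scale s n a b : - 5 ^+ n <= a -> b <= 5 ^+ n ->
  mass s (2 * a + 3 * 5 ^+ n) (2 * b + 3 * 5 ^+ n) = ((growth s)%:E * mass s a b)%E.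
Proof.
move=> a1 b1; apply: mass_homog => // x /andP[ax xb].
by apply: gapdist_scale; rewrite ler_norml; apply/andP; split; lra.
Qed.

(** On [0, 1] the distance is 1 - x, and the affine map with ratio r fixes its zero 1. *)
Lemma mass_end s r a b : 0 < r -> r <= 1 -> 0 <= a -> b <= 1 ->
  mass s (r * a + (1 - r)) (r * b + (1 - r)) = ((r `^ (1 - s))%:E * mass s a b)%E.
Proof.
move=> r0 r1 a0 b1; apply: mass_homog => // x /andP[ax xb].
have x01 : 0 <= x <= 1 by apply/andP; split; lra.
have y01 : 0 <= r * x + (1 - r) <= 1 by apply/andP; split; nra.
have [/andP[? ?] /andP[? ?]] := (x01, y01).
by rewrite !gapdist_gap ?ger0_norm//; lra.
Qed.

Lemma mass_split s a p b : a <= p -> p <= b ->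
  mass s a b = (mass s a p + mass s p b)%E.
Proof. exact: (integral_split (measurable_wt s) (wt_ge0 s)). Qed.

Lemma mass_mono s a b c d : a <= c -> d <= b -> (mass s c d <= mass s a b)%E.
Proof.
move=> ac db; apply: (integral_mono (measurable_wt s) (wt_ge0 s)) => //.
by move=> x; rewrite /= !in_itv /= => /andP[? ?]; apply/andP; split; lra.
Qed.

Lemma mass_lower s a b c : a <= b -> 0 <= c ->
  (forall x, a < x < b -> 0 < gapdist x /\ c <= gapdist x `^ (- s)) ->
  ((c * (b - a))%:E <= mass s a b)%E.
Proof.
move=> ab c0 h; apply: (integral_lower (measurable_wt s)) => // x /h[d0].
by rewrite wt_fin// lee_fin.
Qed.

Lemma mass_upper s a b c : a <= b -> 0 <= c ->
  (forall x, a < x < b -> 0 < gapdist x /\ gapdist x `^ (- s) <= c) ->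
  (mass s a b <= (c * (b - a))%:E)%E.
Proof.
move=> ab c0 h; apply: (integral_upper (measurable_wt s) (wt_ge0 s)) => // x /h[d0].
by rewrite wt_fin// lee_fin.
Qed.

Lemma mass_point s a : mass s a a = 0%E.
Proof. by rewrite /mass set_itv_ge ?integral_set0// bnd_simp ltxx. Qed.

Lemma mass_block_step s n : mass s (- 5 ^+ n.+1) (5 ^+ n.+1) =
  ((1 + 2 * growth s)%:E * mass s (- 5 ^+ n) (5 ^+ n))%E.
Proof.
have p := @exp5_gt0 R n; have e : 5 ^+ n.+1 = 5 * 5 ^+ n :> R by rewrite exprS.
have h : mass s (5 ^+ n) (5 ^+ n.+1) =
    ((growth s)%:E * mass s (- 5 ^+ n) (5 ^+ n))%E.
  by rewrite -(@mass_scale s n)//; apply: mass_eq; lra.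
rewrite (@mass_split s _ (- 5 ^+ n) (5 ^+ n.+1)); [|lra|lra].
rewrite (@mass_split s _ (5 ^+ n) (5 ^+ n.+1)); [|lra|lra].
rewrite massN h; set m := mass s _ _; have m0 : (0 <= m)%E by exact: mass_ge0.
have r0 := growth_gt0 s.
rewrite (_ : 1 + 2 * growth s = growth s + (1 + growth s)); last by lra.
have r0' : (0 <= (growth s)%:E)%E by rewrite lee_fin ltW.
by rewrite !EFinD ge0_muleDl ?adde_ge0// ge0_muleDl ?mul1e// addeCA.
Qed.

Lemma mass_block s n : mass s (- 5 ^+ n) (5 ^+ n) =
  (((1 + 2 * growth s) ^+ n)%:E * mass s (-1) 1)%E.
Proof.
elim: n => [|n IH]; first by rewrite !expr0 mul1e.
by rewrite mass_block_step IH muleA -EFinM -exprS.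
Qed.

Lemma mass_half_bound s : (mass s 0 2^-1 <= (2 `^ `|s| / 2)%:E)%E.
Proof.
rewrite -[X in (_ / X)]/(2 : R) -[2^-1 in leRHS](subr0 2^-1).
apply: mass_upper; [lra|exact: powR_ge0|move=> x /andP[x0 x1]].
rewrite gapdist_gap ger0_norm; [|lra..]; split; first lra.
have K1 : 1 <= 2 :> R by lra.
have h1 : 1 / 2 <= 1 - x by lra.
have h2 : 1 - x <= 2 * 1 by lra.
have /andP[_] := @powR_comparable R 1 (1 - x) s 2 ltr01 K1 h1 h2.
by rewrite powR1 mulr1.
Qed.

(* Halving the distance to the endpoint 1 scales the mass by 2^(s-1) < 1, so
   the masses of [0, 1 - 2^-n] are bounded by a geometric series. *)
Lemma mass_gap_fin s : s < 1 -> (mass s 0 1 < +oo)%E.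
Proof.
move=> s1; pose th : R := 2^-1 `^ (1 - s).
have th0 : 0 < th by rewrite powR_gt0// invr_gt0.
have th1 : th < 1.
  rewrite /th /powR gt_eqF ?invr_gt0// -[ltRHS]expR0 ltr_expR lnV ?posrE//.
  have : 0 < ln (2 : R) by rewrite ln_gt0// ltr1n.
  by nra.
pose F n : set (measurableTypeR R) := `]0, 1 - 2^-1 ^+ n[%classic.
(* K solves K = 2^|s| / 2 + th K, the recursion of the induction below. *)
pose K := 2 `^ `|s| / 2 / (1 - th).
have K0 : 0 <= K by rewrite !divr_ge0 ?powR_ge0//; lra.
have hK n : (mass s 0 (1 - 2^-1 ^+ n) <= K%:E)%E.
  elim: n => [|n IH].
    by rewrite expr0 subrr mass_point lee_fin.
  have p : 0 < 2^-1 ^+ n :> R by rewrite exprn_gt0// invr_gt0.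
  have p1 : 2^-1 ^+ n <= 1 :> R by rewrite exprn_ile1//; lra.
  have e : 2^-1 ^+ n.+1 = 2^-1 * 2^-1 ^+ n :> R by rewrite exprS.
  rewrite (@mass_split _ _ 2^-1); [|lra|lra].
  have -> : mass s 2^-1 (1 - 2^-1 ^+ n.+1) = (th%:E * mass s 0 (1 - 2^-1 ^+ n))%E.
    by rewrite -mass_end ?e; [apply: mass_eq; lra|lra..].
  apply: (@le_trans _ _ ((2 `^ `|s| / 2)%:E + th%:E * K%:E)%E).
    by rewrite leeD ?mass_half_bound// lee_pmul2l.
  rewrite -EFinM -EFinD lee_fin /K.
  suff -> : 2 `^ `|s| / 2 + th * (2 `^ `|s| / 2 / (1 - th)) =
    2 `^ `|s| / 2 / (1 - th) by [].
  by field; lra.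
(* Monotone convergence along [F] carries the uniform bound to the whole of ]0, 1[. *)
have FE : `]0, 1[%classic = \bigcup_n F n.
  apply/seteqP; split=> x /=; last first.
    move=> [n _]; rewrite /F /= !in_itv /= => /andP[x0 x1].
    have : 0 < 2^-1 ^+ n :> R by rewrite exprn_gt0// invr_gt0.
    by move=> ?; apply/andP; split; lra.
  rewrite in_itv /= => /andP[x0 x1].
  pose n := (Num.truncn (1 - x)^-1).+1.
  exists n => //; rewrite /F /= in_itv /= x0 /= ltrBrDr -ltrBrDl.
  have h : (1 - x)^-1 < 2 ^+ n.
    by apply: (lt_trans (truncnS_gt _)); rewrite -natrX ltr_nat ltn_expl.
  by rewrite exprVn invf_plt// posrE ?exprn_gt0//; lra.
rewrite /mass FE; apply: (@le_lt_trans _ _ K%:E); last exact: ltry.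
have nF : nondecreasing_seq F.
  move=> m n mn; apply/subsetPset => x; rewrite /F /= !in_itv /= => /andP[-> x1] /=.
  apply: (lt_le_trans x1); rewrite lerD2l lerN2.
  by apply: ler_wiXn2l => //; lra.
have := @ge0_nondecreasing_set_cvg_integral _ _ R F (wt s) mu nF
  (fun i => measurable_itv _) (fun i => measurable_funTS (measurable_wt s))
  (fun i x _ => wt_ge0 s x).
move=> /cvg_lim <-//; apply: lime_le; last exact: nearW.
apply: ereal_nondecreasing_is_cvgn => m n mn.
apply: mass_mono => //; rewrite lerD2l lerN2.
by apply: ler_wiXn2l => //; lra.
Qed.

End Mass.

(** * Real-valued mass and its doubling property *)

Section RealMass.
Context {R : realType} (s : R).
Hypothesis s1 : s < 1.
Local Notation mu := (@lebesgue_measure R).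
Implicit Types (a b c d x u v : R) (n : nat).

Lemma mass_unit_gap : mass s (-1) 1 = (mass s 0 1 + mass s 0 1)%E.
Proof.
rewrite (@mass_split _ s (-1) 0); [|lra|lra]; congr (_ + _)%E.
by rewrite -{1}oppr0 massN.
Qed.

(** Every interval lies in some block, whose mass is a multiple of that of the central gap. *)
Lemma mass_fin a b : mass s a b \is a fin_num.
Proof.
have [n hn] : exists n, Num.max `|a| `|b| <= 5 ^+ n.
  exists (Num.truncn (Num.max `|a| `|b|)).+1; apply/ltW/(lt_trans (truncnS_gt _)).
  by rewrite -natrX ltr_nat ltn_expl.
move: hn; rewrite ge_max !ler_norml => /andP[/andP[h1 _] /andP[_ h2]].
rewrite ge0_fin_numE ?mass_ge0//; apply: (le_lt_trans (mass_mono _ h1 h2)).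
rewrite mass_block mass_unit_gap -ge0_fin_numE; last first.
  apply: mule_ge0; last by rewrite adde_ge0 ?mass_ge0.
  by rewrite lee_fin exprn_ge0// addr_ge0// mulr_ge0// ltW// growth_gt0.
by rewrite fin_numM// fin_numD ge0_fin_numE ?mass_ge0// mass_gap_fin.
Qed.

Definition rmass a b : R := fine (mass s a b).

Lemma rmassE a b : mass s a b = (rmass a b)%:E.
Proof. by rewrite /rmass fineK// mass_fin. Qed.

Lemma rmass_ge0 a b : 0 <= rmass a b.
Proof. by rewrite -lee_fin -rmassE mass_ge0. Qed.

Lemma rmass_mono a b c d : a <= c -> d <= b -> rmass c d <= rmass a b.
Proof. by move=> ? ?; rewrite -lee_fin -!rmassE mass_mono. Qed.

Lemma rmassN a b : rmass (- b) (- a) = rmass a b.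
Proof. by rewrite /rmass massN. Qed.

Lemma rmass_scale n a b : - 5 ^+ n <= a -> b <= 5 ^+ n ->
  rmass (2 * a + 3 * 5 ^+ n) (2 * b + 3 * 5 ^+ n) = growth s * rmass a b.
Proof.
by move=> h1 h2; apply/EFin_inj; rewrite EFinM -!rmassE mass_scale.
Qed.

Lemma rmass_split a p b : a <= p -> p <= b -> rmass a b = rmass a p + rmass p b.
Proof.
by move=> h1 h2; apply/EFin_inj; rewrite EFinD -!rmassE -mass_split.
Qed.

Lemma rmass_point a : rmass a a = 0. Proof. by rewrite /rmass mass_point. Qed.

Let s1' : 0 <= 1 - s. Proof. by rewrite subr_ge0 ltW. Qed.

(** The middle half of [u, v] stays away from u and v, hence from the zeros -1 and 1 of the
    distance. *)
Let d_lower x u v : -1 <= u -> v <= 1 -> u + (v - u) / 4 < x ->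
  x < v - (v - u) / 4 -> (v - u) / 4 <= gapdist x /\ gapdist x <= 1.
Proof.
move=> h1 h2 h3 h4; have vu : 0 <= v - u by lra.
rewrite gapdist_gap; last by rewrite ler_norml; apply/andP; split; lra.
split; last by rewrite lerBlDr lerDl.
by rewrite lerBrDr -lerBrDl ler_norml; apply/andP; split; lra.
Qed.

(** On the middle half the distance lies between h and 1, so for either sign of s the weight is at
    least h^|s| >= h^q; the length supplies one more factor h. *)
Lemma rmass_base_lower : exists c q, 0 < c /\
  forall a b, -1 <= a -> a <= b -> b <= 1 -> c * ((b - a) / 2) ^+ q <= rmass a b.
Proof.
pose q := (Num.truncn `|s|).+1.
have hq : `|s| <= q%:R by apply/ltW/truncnS_gt.
exists (2^-1 ^+ q.+1), q.+1; split; first by rewrite exprn_gt0// invr_gt0.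
move=> a b a1; rewrite le_eqVlt => /predU1P[->|ab] b1.
  by rewrite subrr mul0r expr0n mulr0 rmass_ge0.
pose h := (b - a) / 4; have h0 : 0 < h by rewrite /h; lra.
have h1 : h <= 1 by rewrite /h; lra.
rewrite -exprMn (_ : 2^-1 * _ = h); last by rewrite /h; lra.
apply: (@le_trans _ _ (rmass (a + h) (b - h))); last by apply: rmass_mono; lra.
rewrite -lee_fin -rmassE.
apply: (@le_trans _ _ (h ^+ q * ((b - h) - (a + h)))%:E).
  rewrite lee_fin exprSr; apply: ler_wpM2l; first by rewrite exprn_ge0// ltW.
  by rewrite /h; lra.
apply: mass_lower; [rewrite /h; lra|by rewrite exprn_ge0// ltW|].
move=> x /andP[x1 x2]; have [g1 g2] := d_lower a1 b1 x1 x2.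
split; first exact: lt_le_trans g1.
apply: (@le_trans _ _ (h `^ `|s|)).
  by rewrite -(powR_mulrn _ (ltW h0)); apply: ger_powR => //; rewrite h0.
have [s0|s0] := leP 0 s.
  rewrite powRN -[leLHS]mul1r.
  apply: (@le_trans _ _ 1).
    by rewrite mul1r powR_le1// ltW.
  rewrite invf_ge1 ?powR_gt0//; last exact: lt_le_trans g1.
  by rewrite powR_le1 ?gapdist_ge0.
by rewrite ltr0_norm// powR_le_base ?oppr_ge0 ?(ltW s0) ?(ltW h0).
Qed.

(** On the middle half of [u, v] the distance is between l/16 and 4 l, so the weight is l^(-s) up to
    a factor 16^|s|, over a length of at least l/8. *)
Lemma rmass_lower_scale u v l : -1 <= u -> v <= 1 -> 0 < l -> l <= 4 * (v - u) ->
  (forall x, u < x < v -> gapdist x <= 4 * l) ->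
  (16 `^ `|s|)^-1 / 8 * l `^ (1 - s) <= rmass u v.
Proof.
move=> u1 v1 l0 lv dl; have K0 : 0 < 16 `^ `|s| :> R by exact: powR_gt0.
pose h := (v - u) / 4; have lh : l / 16 <= h by rewrite /h; lra.
apply: (@le_trans _ _ (rmass (u + h) (v - h))); last by apply: rmass_mono; lra.
rewrite -lee_fin -rmassE.
pose c := (16 `^ `|s|)^-1 * l `^ (- s).
have c0 : 0 <= c by rewrite mulr_ge0 ?invr_ge0 ?powR_ge0.
apply: (@le_trans _ _ (c * ((v - h) - (u + h)))%:E).
  rewrite lee_fin powRD; last by apply/implyP => _; rewrite gt_eqF.
  rewrite powRr1 ?(ltW l0)// /c.
  rewrite (_ : _ / 8 * _ = (16 `^ `|s|)^-1 * l `^ (- s) * (l / 8)); last by field; lra.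
  by apply: ler_wpM2l => //; rewrite /h; lra.
apply: mass_lower => //; first by rewrite /h; lra.
move=> x /andP[x1 x2]; have [g1 g2] := d_lower u1 v1 x1 x2.
split; first by apply: lt_le_trans g1; lra.
have K1 : 1 <= 16 :> R by lra.
have g3 : gapdist x <= 16 * l.
  apply: (@le_trans _ _ (4 * l)); last by lra.
  by apply: dl; apply/andP; split; lra.
have g4 : l / 16 <= gapdist x by lra.
by have /andP[] := @powR_comparable R l (gapdist x) s 16 l0 K1 g4 g3.
Qed.

(** For u >= 0 this follows from the exact scaling of [mass_end]; for u < 0 the whole gap has mass 2
    [rmass 0 1] and the power is at least 1. *)
Lemma rmass_upper_scale u : -1 <= u -> u <= 1 ->
  rmass u 1 <= 2 * rmass 0 1 * (1 - u) `^ (1 - s).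
Proof.
move=> u1; rewrite le_eqVlt => /predU1P[->|u2].
  by rewrite rmass_point !mulr_ge0 ?rmass_ge0 ?powR_ge0.
have T0 := rmass_ge0 0 1.
have [u0|u0] := ltP u 0.
  apply: (@le_trans _ _ (rmass (-1) 1)); first exact: rmass_mono.
  have -> : rmass (-1) 1 = 2 * rmass 0 1.
    by apply/EFin_inj; rewrite -rmassE mass_unit_gap !rmassE -EFinD; congr EFin; lra.
  by apply: ler_peMr; [rewrite mulr_ge0|apply: powR_ge1 => //; lra].
have -> : rmass u 1 = (1 - u) `^ (1 - s) * rmass 0 1.
  apply/EFin_inj; rewrite EFinM -!rmassE -mass_end; [apply: mass_eq; ring|lra..].
by rewrite mulrC; apply: ler_wpM2r; [exact: powR_ge0|lra].
Qed.

(** Let l be the length of [a, b]. If [gapdist a] is at least 2 l, the distance stays within a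
    factor 2 of it on [a, b]. Otherwise [a, b] lies within 3 l of -1 or 1; its mass is at most, and
    that of [c, d] at least, a multiple of l^(1-s). *)
Lemma rmass_base_doubling : exists C, forall a b c d,
  -1 <= a -> a <= c -> c <= d -> d <= b -> b <= 1 -> b - a <= 2 * (d - c) ->
  rmass a b <= C * rmass c d.
Proof.
pose P : R := 2 `^ `|s|; have P0 : 0 < P by exact: powR_gt0.
pose T := 2 * rmass 0 1; have T0 : 0 <= T by rewrite mulr_ge0 ?rmass_ge0.
pose c0 := (16 `^ `|s|)^-1 / 8 : R.
have c00 : 0 < c0 by rewrite divr_gt0// invr_gt0 powR_gt0.
pose C1 := 2 * (P * P); pose C2 := T * 3 `^ (1 - s) / c0.
have C10 : 0 <= C1 by rewrite !mulr_ge0// ltW.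
have C20 : 0 <= C2 by rewrite divr_ge0 ?(ltW c00)// mulr_ge0// powR_ge0.
exists (C1 + C2) => a b c d a1 ac cd db b1 h.
suff [h1|h1] : rmass a b <= C1 * rmass c d \/ rmass a b <= C2 * rmass c d.
- by apply: (le_trans h1); rewrite ler_wpM2r ?rmass_ge0// lerDl.
- by apply: (le_trans h1); rewrite ler_wpM2r ?rmass_ge0// lerDr.
have [ab|ab] := ltP a b; last first.
  by left; rewrite (_ : b = a) ?rmass_point ?mulr_ge0 ?rmass_ge0//; lra.
pose l := b - a; have l0 : 0 < l by rewrite /l; lra.
have dE x : a <= x -> x <= b -> gapdist x = 1 - `|x|.
  by move=> x1 x2; rewrite gapdist_gap// ler_norml; apply/andP; split; lra.
have dlip x : a <= x -> x <= b -> gapdist a - l <= gapdist x <= gapdist a + l.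
  move=> x1 x2; have := gapdist_lip a x; have := gapdist_lip x a.
  rewrite (ler0_norm (_ : a - x <= 0)) ?(ger0_norm (_ : 0 <= x - a)); [|lra|lra].
  by move=> ? ?; apply/andP; split; rewrite /l; lra.
have [big|small] := leP (2 * l) (gapdist a).
  left; set L := gapdist a in big dlip *; have L0 : 0 < L by lra.
  have K1 : 1 <= 2 :> R by lra.
  have cmp x : a <= x -> x <= b ->
      0 < gapdist x /\ P^-1 * L `^ (- s) <= gapdist x `^ (- s) <= P * L `^ (- s).
    move=> x1 x2; have /andP[g1 g2] := dlip x x1 x2; split; first lra.
    by apply: powR_comparable => //; lra.
  have Ls0 : 0 <= L `^ (- s) by exact: powR_ge0.
  have up : rmass a b <= P * L `^ (- s) * l.
    rewrite -lee_fin -rmassE; apply: mass_upper; [lra|by rewrite mulr_ge0// ltW|].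
    by move=> x /andP[x1 x2]; have [? /andP[_ ?]] := cmp x (ltW x1) (ltW x2).
  have low : P^-1 * L `^ (- s) * (d - c) <= rmass c d.
    rewrite -lee_fin -rmassE; apply: mass_lower => //.
      by rewrite mulr_ge0// invr_ge0 ltW.
    move=> x /andP[x1 x2].
    have [? /andP[? _]] := cmp x (le_trans ac (ltW x1)) (le_trans (ltW x2) db).
    by split.
  apply: (le_trans up); apply: le_trans (ler_wpM2l C10 low).
  rewrite /C1 (_ : 2 * (P * P) * _ = P * L `^ (- s) * (2 * (d - c))); last first.
    by field; lra.
  by apply: ler_wpM2l; [rewrite mulr_ge0// ltW|rewrite /l; lra].
right.
have up : rmass a b <= T * (3 * l) `^ (1 - s).
  have mono t : 0 <= t -> t <= 3 * l -> T * t `^ (1 - s) <= T * (3 * l) `^ (1 - s).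
    by move=> t0 tl; apply: ler_wpM2l => //; apply: powR_le_base => //; lra.
  (* The sign of a tells which end of the gap is near. If it is -1, then b is at distance less than
     2 l + l from it, whence the factor 3. *)
  have [a0|a0] := leP 0 a.
    apply: (@le_trans _ _ (rmass a 1)); first exact: rmass_mono.
    apply: (le_trans (rmass_upper_scale a1 _)); first by lra.
    apply: mono; first by lra.
    by move: small; rewrite dE ?(ger0_norm a0)//; lra.
  apply: (@le_trans _ _ (rmass (-1) b)); first exact: rmass_mono.
  rewrite -rmassN opprK; apply: (le_trans (rmass_upper_scale _ _)); [lra|lra|].
  apply: mono; first by lra.
  by move: small; rewrite dE ?(ltr0_norm a0)// /l; lra.
have low : c0 * l `^ (1 - s) <= rmass c d.
  apply: rmass_lower_scale => //; [lra|lra|rewrite /l; lra|].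
  move=> x /andP[x1 x2].
  have /andP[_] : gapdist a - l <= gapdist x <= gapdist a + l by apply: dlip; lra.
  by lra.
apply: (le_trans up); apply: le_trans (ler_wpM2l C20 low).
rewrite powRM ?(ltW l0)// /C2 le_eqVlt; apply/orP; left; apply/eqP; field; lra.
Qed.

(** On both sides of 1 the masses are governed by l^(1-s), because [1, 5] is a copy of the gap, at
    the cost of a factor [growth s]. *)
Lemma rmass_base_straddle : exists C, forall r t u v,
  0 <= r <= 2 -> 0 <= t <= 4 -> u <= v ->
  (1 - r <= u /\ v <= 1) \/ (1 <= u /\ v <= 1 + t) ->
  r + t <= 4 * (v - u) ->
  rmass (1 - r) 1 + rmass 1 (1 + t) <= C * rmass u v.
Proof.
pose T := 2 * rmass 0 1; have T0 : 0 <= T by rewrite mulr_ge0 ?rmass_ge0.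
pose c0 := (16 `^ `|s|)^-1 / 8 : R.
have c00 : 0 < c0 by rewrite divr_gt0// invr_gt0 powR_gt0.
have k0 := growth_gt0 s.
pose C := (1 + growth s) * T / c0.
have C0 : 0 <= C by rewrite divr_ge0 ?(ltW c00)// mulr_ge0// addr_ge0// ltW.
have right w z : 1 <= w -> z <= 5 ->
    rmass w z = growth s * rmass ((w - 3) / 2) ((z - 3) / 2).
  move=> h1 h2; rewrite -(@rmass_scale 0) expr0; [|lra|lra].
  by rewrite /rmass; congr fine; apply: mass_eq; lra.
exists C => r t u v /andP[r0 r2] /andP[t0 t4] uv huv h.
have [l0|l0] := ltP 0 (r + t); last first.
  have rE : r = 0 by lra.
  have tE : t = 0 by lra.
  by rewrite rE tE subr0 addr0 rmass_point addr0 mulr_ge0 ?rmass_ge0.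
set l := r + t in h l0 *.
have mono x : 0 <= x -> x <= l -> T * x `^ (1 - s) <= T * l `^ (1 - s).
  by move=> x0 xl; apply: ler_wpM2l => //; apply: powR_le_base => //; lra.
have up1 : rmass (1 - r) 1 <= T * l `^ (1 - s).
  apply: (le_trans (rmass_upper_scale _ _)); [lra|lra|].
  by rewrite subKr; apply: mono; rewrite /l; lra.
have up2 : rmass 1 (1 + t) <= growth s * (T * l `^ (1 - s)).
  rewrite right; [|lra|lra]; rewrite ler_pM2l// -rmassN.
  rewrite (_ : - ((1 - 3) / 2) = 1); last by lra.
  apply: (le_trans (rmass_upper_scale _ _)); [lra|lra|].
  by apply: mono; rewrite /l; lra.
have low : c0 * l `^ (1 - s) <= rmass u v.
  case: huv => -[h1 h2].
    apply: rmass_lower_scale => //; [lra|].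
    move=> x /andP[x1 x2]; apply: (@le_trans _ _ r); last by rewrite /l; lra.
    rewrite gapdist_gap; last by rewrite ler_norml; apply/andP; split; lra.
    by have := ler_norm x; lra.
  rewrite right; [|lra|lra].
  (* The pull-back halves l and [growth s] compensates: 2^(1-s) (l/2)^(1-s) = l^(1-s). *)
  have -> : c0 * l `^ (1 - s) = growth s * (c0 * (l / 2) `^ (1 - s)).
    have l2 : 0 <= l / 2 by lra.
    rewrite mulrCA /growth -powRM//; congr (_ * _ `^ _); lra.
  rewrite ler_pM2l//; apply: rmass_lower_scale => //; [lra|lra|lra|lra|].
  move=> x /andP[x1 x2]; rewrite gapdist_gap; last first.
    by rewrite ler_norml; apply/andP; split; lra.
  by have := ler_norm (- x); rewrite normrN /l; lra.
apply: le_trans (ler_wpM2l C0 low).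
rewrite (_ : C * _ = T * l `^ (1 - s) + growth s * (T * l `^ (1 - s))).
  exact: lerD.
by rewrite /C; field; lra.
Qed.

Lemma rmass_doubling : exists C, forall a b c d,
  a <= c -> c <= d -> d <= b -> b - a <= 2 * (d - c) -> rmass a b <= C * rmass c d.
Proof.
apply: (@self_similar_doubling R rmass (growth s)).
- exact: growth_gt0.
- by move=> a b _; exact: rmass_ge0.
- by move=> a b c d ac _; exact: rmass_mono.
- exact: rmassN.
- by move=> n a b /andP[h1 h2]; rewrite -rmass_split.
- by move=> n a b h1 _ h2; exact: rmass_scale.
- exact: rmass_base_lower.
- exact: rmass_base_doubling.
- exact: rmass_base_straddle.
Qed.

End RealMass.

(** * From open intervals to arbitrary bounded intervals *)

Section DoublingWeight.
Context {R : realType}.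
Local Notation mu := (@lebesgue_measure R).

Lemma bounded_set_bound (K : set R) : bounded_set K ->
  exists M : R, forall x, K x -> `|x| <= M.
Proof. by move=> [M [_ h]]; exists (M + 1) => x; apply: (h (M + 1)); lra. Qed.

(** The endpoints are the infimum and the supremum; whether X contains them does not affect its
    measure. *)
Lemma interval_hull (X : set R) : X !=set0 -> bounded_set X -> is_interval X ->
  exists a b : R, [/\ a <= b, `]a, b[%classic `<=` X, X `<=` `[a, b]%classic &
    mu X = (b - a)%:E].
Proof.
move=> [x0 Xx0] /bounded_set_bound[M hM] iX.
have Xinf : has_inf X.
  by split; [exists x0|exists (- M) => x /hM; rewrite ler_norml => /andP[]].
have Xsup : has_sup X.
  by split; [exists x0|exists M => x /hM; rewrite ler_norml => /andP[]].
have h1 x : X x -> inf X <= x by apply: ge_inf; exact: Xinf.2.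
have h2 x : X x -> x <= sup X by apply: ub_le_sup; exact: Xsup.2.
have ab : inf X <= sup X by apply: le_trans (h1 _ Xx0) (h2 _ Xx0).
have s1 : `]inf X, sup X[%classic `<=` X.
  move=> x; rewrite /= in_itv /= => /andP[ax xb].
  have [y Xy yx] := inf_lt Xinf.1 ax.
  have [z Xz xz] := sup_gt Xsup.1 xb.
  by apply: (iX y z) => //; rewrite (ltW yx) (ltW xz).
have s2 : X `<=` `[inf X, sup X]%classic.
  by move=> x Xx; rewrite /= in_itv /= h1// h2.
exists (inf X), (sup X); split=> //.
have mX : measurable X by exact: is_interval_measurable.
apply/le_anti/andP; split.
  apply: (@le_trans _ _ (mu `[inf X, sup X]%classic)).
    by apply: le_measure => //; rewrite ?inE.
  rewrite lebesgue_measure_itv /= lte_fin; case: ltP => // _.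
  by rewrite lee_fin subr_ge0.
rewrite -lebesgue_measure_oo//.
by apply: le_measure => //; rewrite ?inE.
Qed.

Variable s : R.
Hypothesis s1 : s < 1.

Lemma mass_cc (a b : R) :
  (\int[mu]_(x in `[a, b]%classic) wt s x = mass s a b)%E.
Proof.
have m D : measurable_fun D (wt s) by exact: measurable_funTS (measurable_wt s).
rewrite -(@integral_itv_obnd_cbnd _ a (BRight b)) //.
rewrite /mass (@integral_itv_bndo_bndc _ (BRight a) b)//.
Qed.

Lemma weight_wt : weight (wt s).
Proof.
split=> [x|K cK]; first exact: wt_ge0.
have mK : measurable K by exact: compact_measurable.
have [M hM] := bounded_set_bound (compact_bounded cK).
have m D : measurable_fun D (wt s) by exact: measurable_funTS (measurable_wt s).
apply: (@integrableS _ _ R mu `[- M, M]%classic) => //.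
  by move=> x /hM; rewrite ler_norml /= in_itv.
apply/integrableP; split; first exact: measurable_funTS (measurable_wt s).
have : (mass s (- M) M < +oo)%E by rewrite (rmassE s1) ltry.
rewrite -mass_cc; apply: le_lt_trans; rewrite le_eqVlt; apply/predU1P; left.
by apply: eq_integral => x _; rewrite gee0_abs ?wt_ge0.
Qed.

Lemma doubling_weight_wt : doubling_weight (wt s).
Proof.
split; first exact: weight_wt.
have [C0 hC0] := rmass_doubling s1.
have hC a b c d : a <= c -> c <= d -> d <= b -> b - a <= 2 * (d - c) ->
    rmass s a b <= `|C0| * rmass s c d.
  move=> h1 h2 h3 h4; apply: (le_trans (hC0 _ _ _ _ h1 h2 h3 h4)).
  by rewrite ler_wpM2r ?rmass_ge0// ler_norm.
exists `|C0| => J K iJ iK bK JK muJK.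
have mJ : measurable J by exact: is_interval_measurable.
have mK : measurable K by exact: is_interval_measurable.
have rhs0 : (0 <= `|C0|%:E * \int[mu]_(x in J) wt s x)%E.
  by rewrite mule_ge0 ?lee_fin// integral_ge0// => x _; exact: wt_ge0.
have [->|/set0P K0] := eqVneq K set0; first by rewrite integral_set0.
have [a [b [ab abK Kab muK]]] := interval_hull K0 bK iK.
have leK : (\int[mu]_(x in K) wt s x <= (rmass s a b)%:E)%E.
  rewrite -(rmassE s1) -mass_cc.
  by apply: (integral_mono (measurable_wt s) (wt_ge0 s)).
apply: (le_trans leK).
have [eab|nab] := eqVneq a b.
  by rewrite eab rmass_point.
(* An empty J would make K null, against a <> b. *)
have [J0|/set0P J0] := eqVneq J set0.
  move: muJK; rewrite J0 measure0 mule0 muK lee_fin => h.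
  by case/eqP: nab; lra.
have bJ : bounded_set J.
  have [M hM] := bounded_set_bound bK.
  exists M; split; first exact: num_real.
  by move=> y My x /JK /hM h; apply: (le_trans h); exact: ltW.
have [c [d [cd cdJ Jcd muJ]]] := interval_hull J0 bJ iJ.
move: muJK; rewrite muK muJ -EFinM lee_fin => h.
have nab' : a < b by rewrite lt_neqAle nab.
have cd' : c < d by lra.
have cdK x : c < x -> x < d -> a <= x <= b.
  move=> x1 x2; have /cdJ/JK/Kab : `]c, d[%classic x by rewrite /= in_itv /= x1.
  by rewrite /= in_itv.
have ac : a <= c.
  (* If c < a, the midpoint of c and min(a, d) is in ]c, d[, hence in K, yet left of a. *)
  rewrite leNgt; apply/negP => ca; pose x := (c + Num.min a d) / 2.
  have [m1 m2] : Num.min a d <= a /\ Num.min a d <= d.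
    by rewrite !ge_min !lexx orbT.
  have m3 : c < Num.min a d by rewrite lt_min ca.
  have : a <= x <= b by apply: cdK; rewrite /x; lra.
  by rewrite /x => /andP[]; lra.
have db : d <= b.
  rewrite leNgt; apply/negP => bd; pose x := (d + Num.max b c) / 2.
  have [m1 m2] : b <= Num.max b c /\ c <= Num.max b c.
    by rewrite !le_max !lexx orbT.
  have m3 : Num.max b c < d by rewrite gt_max bd.
  have : a <= x <= b by apply: cdK; rewrite /x; lra.
  by rewrite /x => /andP[]; lra.
apply: (@le_trans _ _ (`|C0| * rmass s c d)%:E).
  by rewrite lee_fin hC.
rewrite EFinM; apply: lee_pmul => //; rewrite ?lee_fin ?rmass_ge0//.
rewrite -(rmassE s1).
by apply: (integral_mono (measurable_wt s) (wt_ge0 s)).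
Qed.

End DoublingWeight.

(** * Failure of the Muckenhoupt conditions *)

Section NotAinfty.
Context {R : realType}.
Local Notation mu := (@lebesgue_measure R).
Implicit Types (s p : R) (n : nat).

Lemma powR_exprn (x t : R) n : 0 <= x -> (x ^+ n) `^ t = (x `^ t) ^+ n.
Proof.
move=> x0; rewrite -(powR_mulrn n x0) -(powR_mulrn n (powR_ge0 x t)) -!powRrM.
by rewrite mulrC.
Qed.

(** Ratio of the averages over successive blocks: the mass is multiplied by 1 + 2 [growth s], the
    length by 5. It equals E[X^(-s)] with X the random scaling factor. *)
Definition mean_growth s : R := (1 + 2 * growth s) / 5.

Lemma mean_growth_gt0 s : 0 < mean_growth s.
Proof. by rewrite divr_gt0//; have := growth_gt0 s; lra. Qed.

(* With 2^(-s) = u^5 this is the weighted AM-GM inequality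
   (1 + 4 u^5) / 5 > u^4. *)
Lemma mean_growth_bound s : s != 0 -> (2 `^ (- s / 5)) ^+ 4 < mean_growth s.
Proof.
move=> s0; set u := 2 `^ _; have u0 : 0 < u by exact: powR_gt0.
have u1 : u != 1.
  have l2 : 0 < ln (2 : R) by rewrite ln_gt0// ltr1n.
  apply/eqP => /(congr1 (@ln R)); rewrite ln_powR ln1 => /eqP.
  by rewrite !mulf_eq0 oppr_eq0 (negbTE s0) (gt_eqF l2) invr_eq0 pnatr_eq0.
have -> : mean_growth s = (1 + 4 * u ^+ 5) / 5.
  have -> : u ^+ 5 = 2 `^ (- s).
    by rewrite /u -powR_mulrn ?powR_ge0// -powRrM divfK// pnatr_eq0.
  rewrite /mean_growth /growth powRD ?powRr1//; last by rewrite pnatr_eq0 implybT.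
  by congr (_ / 5); lra.
rewrite ltr_pdivlMr// -subr_gt0.
(* Apart from the double root at u = 1 the factors are positive, hence strictness. *)
have -> : 1 + 4 * u ^+ 5 - u ^+ 4 * 5 =
  (u - 1) ^+ 2 * (4 * u ^+ 3 + 3 * u ^+ 2 + 2 * u + 1) by ring.
rewrite mulr_gt0 ?exprn_even_gt0 ?subr_eq0//.
by have := exprn_gt0 3 u0; have := exprn_gt0 2 u0; lra.
Qed.

(** The lower bounds of [mean_growth_bound] for s and s / (1 - p) cancel: v is u to the power 1 / (1
    - p), so v^(4 (p - 1)) = u^(-4). *)
Lemma mean_growth_product s p : s != 0 -> 1 < p ->
  1 < mean_growth s * mean_growth (s / (1 - p)) `^ (p - 1).
Proof.
move=> s0 p1; have q0 : s / (1 - p) != 0.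
  by rewrite mulf_neq0// invr_eq0; apply/eqP; lra.
have h1 := mean_growth_bound s0; have h2 := mean_growth_bound q0.
set u := 2 `^ (- s / 5) in h1; have u0 : 0 < u by exact: powR_gt0.
set v := 2 `^ _ in h2; have v0 : 0 < v by exact: powR_gt0.
have vp : (v ^+ 4) `^ (p - 1) = (u ^+ 4)^-1.
  rewrite -!powR_mulrn ?(ltW u0) ?(ltW v0)// -!powRN /u /v -!powRrM.
  by congr (_ `^ _); field; apply/eqP; lra.
apply: (@le_lt_trans _ _ (u ^+ 4 * (v ^+ 4) `^ (p - 1))).
  by rewrite vp mulfV// gt_eqF// exprn_gt0.
have V0 : 0 < (v ^+ 4) `^ (p - 1) by rewrite powR_gt0// exprn_gt0.
apply: (@lt_le_trans _ _ (mean_growth s * (v ^+ 4) `^ (p - 1))).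
  by rewrite ltr_pM2r.
apply: ler_wpM2l; first exact/ltW/mean_growth_gt0.
by apply: powR_le_base; [lra|by rewrite exprn_ge0// ltW|exact: ltW].
Qed.

Lemma avg_oo (w : R -> \bar R) (a b : R) : a < b ->
  avg w `]a, b[%classic = ((b - a)^-1%:E * \int[mu]_(x in `]a, b[%classic) w x)%E.
Proof.
move=> ab; rewrite /avg lebesgue_measure_oo ?(ltW ab)// inver gt_eqF//.
by rewrite subr_gt0.
Qed.

Lemma mass_gap_lower s : ((2 `^ `|s|)^-1%:E <= mass s (-1) 1)%E.
Proof.
apply: (@le_trans _ _ (mass s (- 2^-1) 2^-1)); last by apply: mass_mono; lra.
apply: (@le_trans _ _ ((2 `^ `|s|)^-1 * (2^-1 - - 2^-1))%:E).
  by rewrite lee_fin (_ : 2^-1 - - 2^-1 = 1) ?mulr1//; lra.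
apply: mass_lower; [lra|by rewrite invr_ge0 powR_ge0|move=> x /andP[x0 x1]].
have xh : `|x| <= 2^-1 by rewrite ler_norml; apply/andP; split; lra.
rewrite gapdist_gap; last lra; split; first lra.
have K1 : 1 <= 2 :> R by lra.
have h1 : 1 / 2 <= 1 - `|x| by lra.
have h2 : 1 - `|x| <= 2 * 1 by have := normr_ge0 x; lra.
have /andP[+ _] := @powR_comparable R 1 (1 - `|x|) s 2 ltr01 K1 h1 h2.
by rewrite powR1 mulr1.
Qed.

(** A lower bound for the average over [-1, 1]: mass at least 2^(-|s|), length 2. *)
Definition mean_base s : R := (2 * 2 `^ `|s|)^-1.

Lemma mean_base_gt0 s : 0 < mean_base s.
Proof. by rewrite invr_gt0 mulr_gt0// powR_gt0. Qed.

Lemma avg_block_lower s n :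
  ((mean_base s * mean_growth s ^+ n)%:E <=
   avg (wt s) `](- 5 ^+ n)%R, (5 ^+ n)%R[%classic)%E.
Proof.
have p := @exp5_gt0 R n.
rewrite avg_oo; last lra.
rewrite -/(mass s (- 5 ^+ n) (5 ^+ n)) mass_block.
apply: (@le_trans _ _ ((5 ^+ n - - 5 ^+ n)^-1%:E *
    (((1 + 2 * growth s) ^+ n)%:E * ((2 `^ `|s|)^-1)%:E))%E).
  rewrite -!EFinM lee_fin /mean_base /mean_growth expr_div_n.
  rewrite le_eqVlt; apply/orP; left; apply/eqP.
  have := powR_gt0 `|s| (ltr0Sn R 1) => ?.
  by field; rewrite !gt_eqF//=; lra.
apply: lee_wpmul2l; first by rewrite lee_fin invr_ge0; lra.
apply: lee_wpmul2l; last exact: mass_gap_lower.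
by rewrite lee_fin exprn_ge0//; have := growth_gt0 s; lra.
Qed.

Lemma unbounded_power (r a C : R) : 1 < r -> 0 < a -> exists n, C < a * r ^+ n.
Proof.
move=> r1 a0; exists (Num.truncn (C / a / (r - 1))).+1.
set n := (_).+1; have hn : C / a / (r - 1) < n%:R by exact: truncnS_gt.
have bern m : 1 + m%:R * (r - 1) <= r ^+ m.
  elim: m => [|m IH]; first by rewrite mul0r addr0 expr0.
  rewrite exprS -natr1; have m0 : 0 <= m%:R :> R by rewrite ler0n.
  have h := ler_wpM2l (_ : 0 <= r) IH; apply: le_trans (h _); last lra.
  have := mulr_ge0 m0 (sqr_ge0 (r - 1)); rewrite expr2; lra.
rewrite mulrC -ltr_pdivrMr//; apply: lt_le_trans (bern n).
by move: hn; rewrite ltr_pdivrMr; lra.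
Qed.

Lemma epow_wtE s t x : s != 0 -> t < 0 -> epow (wt s x) t =
  if gapdist x == 0 then +oo%E else (gapdist x `^ (- (s * t)))%:E.
Proof.
move=> s0 t0; rewrite /epow t0 andbT wtE.
have [d0|d0] := eqVneq (gapdist x) 0; rewrite /=.
  (* On the set, +oo comes from the library power of +oo if s > 0 and from the convention of [epow]
     at 0 if s < 0. *)
  have [sp|sp] := ltP 0 s; first by rewrite poweRyr ?(lt_eqF t0).
  by rewrite d0 powR0 ?eqxx// oppr_eq0.
have dp : 0 < gapdist x by rewrite lt0r d0 gapdist_ge0.
rewrite eqe (gt_eqF (powR_gt0 _ dp)).
by rewrite -powRrM mulNr.
Qed.

(* Only an inequality: the library power satisfies +oo `^ t = +oo for t < 0,
   so the right-hand side is infinite on the set when s > 0. *)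
Lemma wt_le_epow s t x : s != 0 -> t < 0 -> (wt (s * t) x <= epow (wt s x) t)%E.
Proof.
move=> s0 t0; rewrite epow_wtE// wtE.
by case: ifP => [/andP[->]|_] //; case: ifP => // _; exact: leey.
Qed.

Lemma measurable_epow_wt s t : s != 0 -> t < 0 ->
  measurable_fun setT (fun x => epow (wt s x) t).
Proof.
move=> s0 t0; rewrite (funext (fun x => epow_wtE x s0 t0)).
apply: measurable_fun_ifT => //.
  by apply: measurable_fun_eqr => //; exact: measurable_gapdist.
apply/measurable_EFinP; apply: (measurableT_comp (measurable_powR _)).
exact: measurable_gapdist.
Qed.

(** On the block of index n the A_p quotient is at least a r^n, as both averages grow geometrically,
    and r > 1 by [mean_growth_product]. *)
Lemma wt_not_Ap s p : s != 0 -> 1 < p -> ~ muckenhoupt_Ap p (wt s).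
Proof.
move=> s0 p1 [_ hsup]; pose t := (1 - p)^-1.
have t0 : t < 0 by rewrite invr_lt0; lra.
set S := ereal_sup _ in hsup.
pose a := mean_base s * mean_base (s * t) `^ (p - 1).
have a0 : 0 < a by rewrite mulr_gt0 ?powR_gt0 ?mean_base_gt0.
pose r := mean_growth s * mean_growth (s * t) `^ (p - 1).
have r1 : 1 < r by exact: mean_growth_product.
have low n : ((a * r ^+ n)%:E <= S)%E.
  have p5 := @exp5_gt0 R n.
  set B := `](- 5 ^+ n)%R, (5 ^+ n)%R[%classic : set R.
  apply: (@le_trans _ _ (avg (wt s) B * (avg (fun x => epow (wt s x) t) B) `^ (p - 1))%E);
    last first.
    by apply: ereal_sup_ubound; exists (- 5 ^+ n), (5 ^+ n); split=> //; lra.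
  have h1 := avg_block_lower s n.
  have h2 : ((mean_base (s * t) * mean_growth (s * t) ^+ n)%:E <=
      avg (fun x => epow (wt s x) t) B)%E.
    apply: (le_trans (avg_block_lower (s * t) n)).
    rewrite !avg_oo; [|lra|lra].
    apply: lee_wpmul2l; first by rewrite lee_fin invr_ge0; lra.
    apply: ge0_le_integral => //.
    - by move=> x _; exact: wt_ge0.
    - exact: measurable_funTS (measurable_wt _).
    - exact: measurable_funTS (measurable_epow_wt s0 t0).
    - by move=> x _; exact: wt_le_epow.
  have g0 : 0 <= mean_base (s * t) * mean_growth (s * t) ^+ n.
    by rewrite mulr_ge0 ?exprn_ge0// ltW// ?mean_base_gt0 ?mean_growth_gt0.
  have -> : a * r ^+ n = (mean_base s * mean_growth s ^+ n) *
      (mean_base (s * t) * mean_growth (s * t) ^+ n) `^ (p - 1).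
    have b0 := ltW (mean_base_gt0 (s * t)); have c0 := ltW (mean_growth_gt0 (s * t)).
    rewrite (powRM (p - 1) b0 (exprn_ge0 n c0)) /a /r exprMn.
    have -> : (mean_growth (s * t) ^+ n) `^ (p - 1) =
        (mean_growth (s * t) `^ (p - 1)) ^+ n.
      exact: powR_exprn.
    by ring.
  rewrite EFinM; apply: lee_pmul => //.
  - rewrite lee_fin mulr_ge0 ?exprn_ge0// ltW// ?mean_base_gt0 ?mean_growth_gt0//.
  - by rewrite lee_fin powR_ge0.
  - rewrite -poweR_EFin; apply: gt0_ler_poweR => //; first lra.
    + by rewrite in_itv /= leey lee_fin g0.
    + by rewrite in_itv /= leey andbT (le_trans _ h2)// lee_fin.
have [M SM] : exists M : R, (S <= M%:E)%E.
  by move: hsup; case: S {low} => [M| |] //= _; [exists M|exists 0; rewrite leNye].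
have [n hn] := unbounded_power M r1 a0.
have := le_trans (low n) SM; rewrite lee_fin; lra.
Qed.

End NotAinfty.

(** * The case of A_1 and the failure of weak porosity *)

Section Conclusion.
Context {R : realType}.
Local Notation mu := (@lebesgue_measure R).
Implicit Types (s p : R) (n : nat).

(** Turns an essential infimum of the weight into a bound for its reciprocal. At points of the set
    the hypothesis excludes s < 0, since [wt s] vanishes there. *)
Lemma wt_ge_inv s x (y : R) : 0 < y -> (y%:E <= wt s x)%E ->
  (wt (- s) x <= y^-1%:E)%E.
Proof.
move=> y0; rewrite !wtE opprK oppr_gt0.
have [d0|d0] := eqVneq (gapdist x) 0; rewrite /=.
  rewrite d0; have [s0|s0|s0] := ltgtP s 0; rewrite ?lee_fin /powR eqxx /=.
  - by rewrite oppr_eq0 lt_eqF//= leNgt y0.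
  - by move=> _; rewrite gt_eqF//= invr_ge0 ltW.
  - by rewrite s0 oppr0 eqxx /= => y1; rewrite invf_ge1.
have dp : 0 < gapdist x by rewrite lt0r d0 gapdist_ge0.
rewrite !lee_fin powRN => h.
by rewrite -[leLHS]invrK lef_pV2 ?posrE ?invr_gt0 ?powR_gt0.
Qed.

(** With A the average of [wt s] over a block, an A_1 constant C gives [wt (- s)] <= C / A almost
    everywhere there. The averages of the two weights then have product at most C, against
    [mean_growth_product] for p = 2. *)
Lemma wt_not_A1 s : s != 0 -> s < 1 -> ~ muckenhoupt_A1 (wt s).
Proof.
move=> s0 s1 [_ [C [C0 hC]]].
have r1 : 1 < mean_growth s * mean_growth (- s).
  have := @mean_growth_product R s 2 s0 (ltr1n _ 2).
  rewrite (_ : s / (1 - 2) = - s); last by field.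
  rewrite (_ : 2 - 1 = 1); last lra.
  by rewrite powRr1// ltW// mean_growth_gt0.
have a0 : 0 < mean_base s * mean_base (- s) by rewrite mulr_gt0 ?mean_base_gt0.
have [n hn] := unbounded_power C r1 a0.
have p5 := @exp5_gt0 R n.
have ab : - 5 ^+ n < 5 ^+ n :> R by lra.
have low := avg_block_lower s n; have low' := avg_block_lower (- s) n.
have := hC _ _ ab.
pose A : R := (5 ^+ n - - 5 ^+ n)^-1 * rmass s (- 5 ^+ n) (5 ^+ n).
have avgE : avg (wt s) `](- 5 ^+ n)%R, (5 ^+ n)%R[%classic = A%:E.
  by rewrite avg_oo// -/(mass s (- 5 ^+ n) (5 ^+ n)) (rmassE s1) EFinM.
rewrite avgE lee_fin in low; rewrite avgE => hA.
have A0 : 0 < A.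
  by apply: lt_le_trans low; rewrite mulr_gt0 ?exprn_gt0 ?mean_base_gt0 ?mean_growth_gt0.
have Cp : 0 < C.
  rewrite lt0r C0 andbT; apply/eqP => Cz; move: hA.
  by rewrite Cz mul0e lee_fin leNgt A0.
have y0 : 0 < A / C by rewrite divr_gt0.
move: hA; rewrite -lee_pdivrMl// -EFinM mulrC => /ess_infP[N [mN mN0 hN]].
set B := `](- 5 ^+ n)%R, (5 ^+ n)%R[%classic in low' mN0.
have up : (\int[mu]_(x in B) wt (- s) x <= ((A / C)^-1 * (5 ^+ n - - 5 ^+ n))%:E)%E.
  have -> : ((A / C)^-1 * (5 ^+ n - - 5 ^+ n))%:E =
      (\int[mu]_(x in B) cst (A / C)^-1%:E x)%E.
    by rewrite /B integral_cst//= lebesgue_measure_oo// ltW.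
  apply: ae_ge0_le_integral => //.
  - exact: measurable_itv.
  - by move=> x _; exact: wt_ge0.
  - exact: measurable_funTS (measurable_wt _).
  - by move=> x _; rewrite lee_fin invr_ge0 ltW.
  (* [N] is known to be null only for the measure restricted to B. *)
  exists (N `&` B); split=> //; first by apply: measurableI => //; exact: measurable_itv.
  move=> x /= h; have Bx : B x by apply/not_notP => nB; apply: h => /nB.
  split=> //; apply: hN => /= hx; apply: h => _; exact: wt_ge_inv.
rewrite avg_oo// in low'.
have : (mean_base (- s) * mean_growth (- s) ^+ n) * (A / C) <= 1.
  rewrite -ler_pdivlMr// div1r -lee_fin; apply: (le_trans low').
  rewrite lee_pdivrMl; last by lra.
  by rewrite -EFinM mulrC.
rewrite mulrA ler_pdivrMr// mul1r => h2.
have : C < C; last by rewrite ltxx.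
apply: (lt_le_trans hn); apply: le_trans h2.
rewrite exprMn.
have g0 : 0 <= mean_base (- s) * mean_growth (- s) ^+ n.
  by rewrite mulr_ge0 ?exprn_ge0// ltW// ?mean_base_gt0 ?mean_growth_gt0.
apply: le_trans (ler_wpM2l g0 low).
by rewrite le_eqVlt; apply/orP; left; apply/eqP; ring.
Qed.

Lemma wt_not_Ainfty s : s != 0 -> s < 1 -> ~ muckenhoupt_Ainfty (wt s).
Proof.
by move=> s0 s1 [|[p [p1]]]; [exact: wt_not_A1|exact: wt_not_Ap].
Qed.

(** The right child of each block is a copy scaled by 2, so holes double at every level. *)
Lemma max_hole_block n : 2 ^+ n <= max_hole (@gapset R) 0 (5 ^+ n).
Proof.
suff h : 2 ^+ n <= sup (hole (@gapset R) (- 5 ^+ n) (5 ^+ n)).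
  rewrite -[X in max_hole _ X](_ : (- 5 ^+ n + 5 ^+ n) / 2 = 0); last lra.
  rewrite -[X in max_hole _ _ X](_ : (5 ^+ n - - 5 ^+ n) / 2 = 5 ^+ n); last lra.
  by rewrite max_holeE.
elim: n => [|n IH].
  rewrite !expr0; apply: le_trans (sup_hole_lower _ _ _); lra.
have p5 := @exp5_gt0 R n; have e : 5 ^+ n.+1 = 5 * 5 ^+ n :> R by rewrite exprS.
apply: (@le_trans _ _ (sup (hole (@gapset R) (2 * - 5 ^+ n + 3 * 5 ^+ n)
    (2 * 5 ^+ n + 3 * 5 ^+ n)))).
  by rewrite sup_hole_scale// exprS; lra.
by apply: sup_hole_mono; lra.
Qed.

Lemma gapdist_ball x r z : 0 < r -> ball x r `<=` ~` (@gapset R) ->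
  `|x - z| <= r / 2 -> r / 2 <= gapdist z.
Proof.
move=> r0 h xz; apply: gapdist_ge => y Ey.
have : r <= `|x - y| by rewrite leNgt; apply/negP => l; exact: (h y).
have := ler_normD (x - z) (z - y); rewrite addrA subrK; lra.
Qed.

(** For s = -1 the weight is the distance itself, and a hole of radius r contributes at least r^2 /
    2 to its integral: on the middle half, of length r, the distance is at least r/2. With r >= d
    2^n the sum is at least c d 10^n / 2, against a total of 9^n m0. *)
Lemma gapset_not_weakly_porous : ~ weakly_porous (@gapset R).
Proof.
move=> [c [d [/andP[c0 c1] /andP[d0 d1] hP]]].
have s1 : -1 < 1 :> R by lra.
pose m0 := rmass (-1) (-1) 1 : R.
have r1 : 1 < 10 / 9 :> R by lra.
have a0 : 0 < c * d / 2 by rewrite divr_gt0// mulr_gt0.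
(* n is chosen so that (c d / 2) (10/9)^n exceeds m0. *)
have [n hn] := unbounded_power m0 r1 a0.
have p5 := @exp5_gt0 R n.
have [N [xs [rs [rs0 tI sub hr hm]]]] := hP 0 (5 ^+ n) p5.
pose B i := ball (xs i) (rs i).
have mB i : measurable (B i) by exact: measurable_ball.
have muB i : mu (B i) = (rs i *+ 2)%:E by rewrite lebesgue_measure_ball// ltW.
have int_ball i : ((rs i * rs i / 2)%:E <= \int[mu]_(x in B i) wt (-1) x)%E.
  have r0 := rs0 i.
  apply: (@le_trans _ _ (mass (-1) (xs i - rs i / 2) (xs i + rs i / 2))).
    apply: (@le_trans _ _ (rs i / 2 *
        (xs i + rs i / 2 - (xs i - rs i / 2)))%:E).
      by rewrite lee_fin le_eqVlt; apply/orP; left; apply/eqP; field.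
    apply: mass_lower; [lra|lra|move=> x /andP[x1 x2]].
    have h : rs i / 2 <= gapdist x.
      apply: (@gapdist_ball (xs i)) => //; first by move=> z /sub[].
      by rewrite ler_norml; apply/andP; split; lra.
    by rewrite opprK powRr1 ?gapdist_ge0//; split=> //; lra.
  apply: (integral_mono (measurable_wt _) (wt_ge0 _)) => //.
  move=> x; rewrite /= in_itv /= => /andP[x1 x2].
  by rewrite /B /ball /= ltr_norml; apply/andP; split; lra.
have total : (\sum_(i < N) \int[mu]_(x in B i) wt (-1) x <= (9 ^+ n * m0)%:E)%E.
  have -> : (9 ^+ n * m0)%:E = mass (-1) (- 5 ^+ n) (5 ^+ n).
    (* [growth (-1)] is 4, whence 1 + 2 4 = 9. *)
    rewrite mass_block (rmassE s1) -EFinM; congr (_ ^+ _ * _)%:E.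
    by rewrite /growth opprK (_ : 1 + 1 = 2%:R :> R) ?powR_mulrn//; lra.
  rewrite -ge0_integral_bigsetU//=; last 4 first.
  - exact: index_enum_uniq.
  - apply: sub_trivIset tI; exact: subsetT.
  - exact: measurable_funTS (measurable_wt _).
  - by move=> x _; exact: wt_ge0.
  apply: (integral_mono (measurable_wt _) (wt_ge0 _)) => //.
    exact: bigsetU_measurable.
  apply: (@subset_trans _ (ball 0 (5 ^+ n))).
    elim/big_ind: _ => [x []|X Y hX hY|i _ x /sub[]] //.
    by rewrite subUset.
  by move=> x; rewrite /ball /= sub0r normrN ltr_norml in_itv.
have hole_n := max_hole_block n.
have rs_low i : d * 2 ^+ n <= rs i.
  have /andP[h _] := hr i; apply: le_trans h.
  by rewrite ler_pM2l.
have hsum : c * 5 ^+ n <= \sum_(i < N) rs i.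
  move: hm; rewrite (lebesgue_measure_ball _ (ltW p5)) -EFinM.
  rewrite (eq_bigr (fun i => (rs i *+ 2)%:E)); last by move=> i _; exact: muB.
  by rewrite sumEFin lee_fin sumrMnl mulrnAr lerMn2r.
have : c * 5 ^+ n * (d * 2 ^+ n) / 2 <= 9 ^+ n * m0.
  rewrite -lee_fin; apply: le_trans total.
  apply: (@le_trans _ _ (\sum_(i < N) (rs i * rs i / 2)%:E)%E); last exact: lee_sum.
  rewrite sumEFin lee_fin -mulr_suml ler_pM2r ?invr_gt0//.
  apply: (@le_trans _ _ ((\sum_(i < N) rs i) * (d * 2 ^+ n))).
    by rewrite ler_wpM2r// mulr_ge0 ?exprn_ge0// ltW.
  rewrite mulr_suml; apply: ler_sum => i _.
  by rewrite ler_wpM2l// ltW.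
rewrite leNgt => /negP; apply.
have -> : c * 5 ^+ n * (d * 2 ^+ n) / 2 = 9 ^+ n * (c * d / 2 * (10 / 9) ^+ n).
  rewrite expr_div_n (_ : 10 = 5 * 2) ?exprMn; last by ring.
  by field; rewrite expf_neq0.
by rewrite ltr_pM2l// exprn_gt0.
Qed.

End Conclusion.

Theorem theorem1p2 (R : realType) :
  exists E : set R,
    [/\ doubling_max_hole E,
        (forall alpha : R, alpha < 1 -> alpha != 0 ->
           doubling_weight (dist_weight E alpha) /\
           ~ muckenhoupt_Ainfty (dist_weight E alpha)) &
        ~ weakly_porous E].
Proof.
exists gapset; split.
- exact: gapset_doubling_max_hole.
- move=> s s1 s0; split; first exact: doubling_weight_wt.
  exact: wt_not_Ainfty.
- exact: gapset_not_weakly_porous.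
Qed.
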